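(* Let $\mathcal{H}$ be a non-central hyperplane arrangement in $\mathbb{R}^n$ with intersection lattice $\mathcal{L}$ and poset $Q$ of unbounded regions. Then $$\Psi(Q)=\varphi_{ub}\big(\Psi(\mathcal{L}\cup\{\hat0\})\big).$$
   Context: An essential hyperplane arrangement in $\mathbb{R}^n$ is a finite set of affine hyperplanes whose normals span $\mathbb{R}^n$; non-central means the intersection of all hyperplanes is empty. $\mathcal{L}$: all intersections of subsets of the hyperplanes, ordered by reverse inclusion, minimum $\mathbb{R}^n$, maximum $\emptyset$, rank $\rho(x)=n-\dim x$, $\rho(\emptyset)=n+1$; $\mathcal{L}\cup\{\hat0\}$ adjoins a new minimum. The face lattice $T$ consists of the relatively open faces of the induced decomposition of $\mathbb{R}^n$, ordered by $F\le G$ iff $F\subseteq\overline G$, with an adjoined minimum (empty face) and adjoined maximum $\hat1_T$; it is graded of rank $n+2$ and $T^*$ is its dual. The unbounded faces together with $\hat1_T$ form a lower order ideal of $T^*$; $Q$ is this ideal with a maximum adjoined, with rank function that of $T^*$ (the adjoined maximum has rank $n+2$). $\mathbf{a}\mathbf{b}$-index: for a graded poset $P$ of rank $r+1$ and $S\subseteq\{1,\dots,r\}$, $f_S$ counts chains $\hat0<x_1<\cdots<\hat1$ whose set of ranks is exactly $S$, $h_S=\sum_{T\subseteq S}(-1)^{|S-T|}f_T$, $\Psi(P)=\sum_Sh_Su_S\in\mathbb{Z}\langle\mathbf{a},\mathbf{b}\rangle$ with $u_S=u_1\cdots u_r$, $u_i=\mathbf{b}$ if $i\in S$ else $\mathbf{a}$.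 Coproduct: linear $\Delta$ with $\Delta(1)=0$, $\Delta(u_1\cdots u_r)=\sum_{i=1}^ru_1\cdots u_{i-1}\otimes u_{i+1}\cdots u_r$; $\Delta^0=\mathrm{id}$, $\Delta^k=(\Delta^{k-1}\otimes\mathrm{id})\circ\Delta$; $\Delta^{k-1}(v)=\sum_vv_{(1)}\otimes\cdots\otimes v_{(k)}$, and $\sum_vM(v_{(1)},\dots,v_{(k)})$ is the multilinear $M$ applied to $\Delta^{k-1}(v)$. Linear maps on monomials $v$: $\kappa(v)=(\mathbf{a}-\mathbf{b})^m$ if $v=\mathbf{a}^m$, else $0$; $\beta(v)=(\mathbf{a}-\mathbf{b})^m$ if $v=\mathbf{b}^m$, else $0$; $\eta(v)=2(\mathbf{a}-\mathbf{b})^{m+k}$ if $v=\mathbf{b}^m\mathbf{a}^k$, else $0$; $\lambda_{ub}=\eta-2\beta$. Set $\varphi_{ub,1}=\kappa$ and for $k\ge2$ $$\varphi_{ub,k}(v)=\sum_v\kappa(v_{(1)})\,\mathbf{b}\,\eta(v_{(2)})\,\mathbf{b}\cdots\mathbf{b}\,\eta(v_{(k-1)})\,\mathbf{b}\,\lambda_{ub}(v_{(k)}),$$ and $\varphi_{ub}=\sum_{k\ge1}\varphi_{ub,k}$. *)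

(* Defs.v *)
From HB Require Import structures.
From mathcomp Require Import all_boot all_order all_algebra.
From mathcomp Require Import finmap.
From mathcomp.multinomials Require Import monalg.
From mathcomp Require Import mathcomp_extra boolp classical_sets functions cardinality.
From mathcomp Require Import reals topology normedtype.

Set Implicit Arguments.
Unset Strict Implicit.
Unset Printing Implicit Defensive.

Import Order.TTheory GRing.Theory Num.Theory.
Import numFieldNormedType.Exports.

Local Open Scope classical_set_scope.
Local Open Scope ring_scope.

(* Letters are booleans: [false] is the letter a and [true] is the letter b. *)
Notation word := {fmonom bool}.
Notation Zab := {malg int[word]}.

Definition mon (s : seq bool) : Zab := << FMonom s >>.
Definition a : Zab := mon [:: false].
Definition b : Zab := mon [:: true].

Definition linext (K : choiceType) (M : zmodType) (f : K -> M)
    (v : {malg int[K]}) : M :=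
  \sum_(k <- msupp v) f k *~ v@_k.

(* The direct sum of the tensor powers of Z<a,b>: the free Z-module on tuples
   of monomials, [:: w_1; ...; w_k] standing for w_1 (x) ... (x) w_k. *)
Notation Zab_tensor := {malg int[seq word]}.

Definition coproduct (w : word) : Zab_tensor :=
  \sum_(i < size w) << [:: FMonom (take i w); FMonom (drop i.+1 w)] >>.

Definition tensor_id (f : word -> Zab_tensor) (t : seq word) : Zab_tensor :=
  if t is u :: s then linext (fun s' => << s' ++ s >>) (f u) else 0.

Fixpoint coproduct_iter (k : nat) (w : word) : Zab_tensor :=
  if k is k'.+1 then linext (tensor_id (coproduct_iter k')) (coproduct w)
  else << [:: w] >>.

Definition kappa (v : word) : Zab :=
  if v == nseq (size v) false :> seq bool then (a - b) ^+ size v else 0.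

Definition beta (v : word) : Zab :=
  if v == nseq (size v) true :> seq bool then (a - b) ^+ size v else 0.

Definition eta (v : word) : Zab :=
  if v == nseq (count_mem true v) true ++ nseq (count_mem false v) false
     :> seq bool
  then 2 * (a - b) ^+ size v else 0.

Definition lambda_ub (v : word) : Zab := eta v - 2 * beta v.

(* The factor v_(j) of the Sweedler notation is [v_ t j.-1]. *)
Definition phi_ub_k (k : nat) (w : word) : Zab :=
  let v_ (t : seq word) (j : nat) : word := nth (FMonom [::]) t j in
  if k == 1%N then kappa w else
  linext (fun t => kappa (v_ t 0%N)
                   * (\prod_(1 <= j < k.-1) (b * eta (v_ t j)))
                   * (b * lambda_ub (v_ t k.-1)))
         (coproduct_iter k.-1 w).

(* The terms with k > size w + 1 vanish, see [phi_ub_k_eq0]. *)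
Definition phi_ub : Zab -> Zab :=
  linext (fun w : word => \sum_(1 <= k < (size w).+2) phi_ub_k k w).

Lemma msupp_coproduct (w : word) (t : seq word) :
  t \in msupp (coproduct w) ->
  exists u v : word, t = [:: u; v] /\ (size u < size w)%N.
Proof.
suff gen m : (m <= size w)%N ->
    t \in msupp (\sum_(i < m) << [:: FMonom (take i w); FMonom (drop i.+1 w)] >>
                 : Zab_tensor) ->
    exists u v : word, t = [:: u; v] /\ (size u < size w)%N.
  exact: gen.
elim: m => [|m IHm] lem.
  by rewrite big_ord0 msupp0 in_fset0.
rewrite big_ord_recr /= => /(fsubsetP (msuppD_le _ _)); rewrite in_fsetU.
case/orP; first by apply: IHm; exact: ltnW.
rewrite msuppU oner_eq0 in_fset1 => /eqP ->.
exists (FMonom (take m w)), (FMonom (drop m.+1 w)); split => //=.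
by rewrite size_takel // ltnW.
Qed.

Lemma coproduct_iter_eq0 (k : nat) (w : word) :
  (size w < k)%N -> coproduct_iter k w = 0.
Proof.
elim: k w => [//|k IHk] w; rewrite ltnS => lewk /=.
rewrite /linext big1_seq // => t /= /msupp_coproduct[u [v [-> ltuw]]].
rewrite /tensor_id IHk ?(leq_trans ltuw) //.
by rewrite /linext msupp0 big_seq_fset0 mul0rz.
Qed.

Lemma phi_ub_k_eq0 (k : nat) (w : word) :
  ((size w).+1 < k)%N -> phi_ub_k k w = 0.
Proof.
case: k => [//|[//|k]]; rewrite !ltnS => ltwk.
by rewrite /phi_ub_k coproduct_iter_eq0 // /linext msupp0 big_seq_fset0.
Qed.

Record ranked_poset := RankedPoset {
  elt : choiceType;
  carrier : set elt;
  ple : rel elt;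
  pbot : elt;
  ptop : elt;
  prk : elt -> nat
}.

Definition plt (P : ranked_poset) : rel (elt P) :=
  fun x y => (x != y) && ple x y.

Definition ab_degree (P : ranked_poset) : nat := (prk (ptop P)).-1.

(* [S : {set 'I_r}] encodes the set of ranks {i + 1 | i in S} in {1, ..., r}. *)
Definition chains (P : ranked_poset) (S : {set 'I_(ab_degree P)}) :
    set (seq (elt P)) :=
  [set s | [/\ forall x, x \in s -> carrier x,
               path (@plt P) (pbot P) (rcons s (ptop P)) &
               [seq prk x | x <- s] =i [seq (nat_of_ord i).+1 | i in S]]].

Definition flag_f (P : ranked_poset) (S : {set 'I_(ab_degree P)}) : nat :=
  #|` fset_set (chains S)|.

Definition flag_h (P : ranked_poset) (S : {set 'I_(ab_degree P)}) : int :=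
  \sum_(U : {set 'I_(ab_degree P)} | U \subset S)
    (-1) ^+ #|S :\: U| * (flag_f U)%:Z.

Definition ab_index (P : ranked_poset) : Zab :=
  \sum_(S : {set 'I_(ab_degree P)})
    mon [seq i \in S | i <- enum 'I_(ab_degree P)] *~ flag_h S.

Definition hyperplane (R : realType) (n : nat) (u : 'rV[R]_n) (c : R) :
    set 'rV[R]_n :=
  [set x | (x *m u^T) 0 0 = c].

Record arrangement (R : realType) (n : nat) := Arrangement {
  nb_hyp : nat;
  normal : 'I_nb_hyp -> 'rV[R]_n;
  offset : 'I_nb_hyp -> R;
  normal_neq0 : forall i, normal i != 0;
  hyp_inj : injective (fun i => hyperplane (normal i) (offset i))
}.

Section Arrangement.
Context (R : realType) (n : nat) (H : arrangement R n).
Implicit Types X Y F G : set 'rV[R]_n.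

Definition hyp (i : 'I_(nb_hyp H)) : set 'rV[R]_n :=
  hyperplane (normal i) (offset i).

Definition essential : Prop :=
  row_full (\matrix_(i < nb_hyp H) normal i).

Definition noncentral : Prop := \bigcap_i hyp i = set0.

(* The largest k such that X contains k + 1 affinely independent points. *)
Definition dim X : nat :=
  \max_(k < n.+1 | `[< exists x0 (M : 'M[R]_(k, n)),
      [/\ X x0, forall j, X (x0 + row j M) & row_free M] >]) k.

Definition rho X : nat := if X == set0 then n.+1 else (n - dim X)%N.

Definition intersections : set (set 'rV[R]_n) :=
  [set X | exists B : {set 'I_(nb_hyp H)}, X = \bigcap_(i in [set` B]) hyp i].

Definition side (i : 'I_(nb_hyp H)) (x : 'rV[R]_n) : R :=
  Num.sg ((x *m (normal i)^T) 0 0 - offset i).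

Definition faces : set (set 'rV[R]_n) :=
  [set F | exists x, F = [set y | forall i, side i y = side i x]].

(* In both posets below [None] is the adjoined minimum, of rank 0. *)
Definition rank_opt (x : option (set 'rV[R]_n)) : nat :=
  if x is Some X then (rho X).+1 else 0%N.

Definition L_le : rel (option (set 'rV[R]_n)) := fun x y =>
  match x, y with
  | None, _ => true
  | Some X, Some Y => `[< Y `<=` X >]
  | Some _, None => false
  end.

Definition L_hat0 : ranked_poset := {|
  carrier := [set x | if x is Some X then intersections X else True];
  ple := L_le;
  pbot := None;
  ptop := Some set0;
  prk := rank_opt
|}.

(* The order of the dual T^* of the face lattice, [None] being the maximum
   hat1 of T and [Some set0] the empty face.  The rank n + 2 - (dim F + 1) of a
   face F in T^* is [rank_opt (Some F)], and the empty face has rank n + 2. *)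
Definition Tdual_le : rel (option (set 'rV[R]_n)) := fun x y =>
  match x, y with
  | None, _ => true
  | Some F, Some G => `[< G `<=` closure F >]
  | Some _, None => false
  end.

(* The empty face, which is the maximum of T^*, serves as the maximum adjoined
   to the ideal of unbounded faces. *)
Definition Q : ranked_poset := {|
  carrier := [set x | if x is Some F
                      then F = set0 \/ (faces F /\ ~ bounded_set F)
                      else True];
  ple := Tdual_le;
  pbot := None;
  ptop := Some set0;
  prk := rank_opt
|}.

End Arrangement.

(* Main.v *)
Require Import Defs.
From mathcomp Require Import all_boot all_algebra reals.
From HB Require Import structures.
From mathcomp.multinomials Require Import monalg.
From mathcomp Require Import boolp classical_sets cardinality.
From mathcomp Require Import topology function_spaces normedtype derive.
From mathcomp Require Import all_boot all_order all_algebra finmap zify lra.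
Import Defs.

(** Write c = a - b.  The ab-index of a graded poset is the sum, over its
    chains, of the words c^.. b c^.. b ... b c^.., and the coproduct splits such
    a word at its letters b; hence the ab-index is a coalgebra homomorphism.
    Applied to an interval [x, y] of L, the maps kappa, eta and lambda_ub give
    a power of c times, respectively, 1, the sum of the |mu(x, z)| over the
    interval, and that sum minus 2 |mu(x, y)|.  So phi_ub of the ab-index of L
    with a new minimum is again a sum over chains of L, weighted by these
    numbers.

    On the other side, sort the chains of Q by the chain of affine spans of
    their faces.  A chain of spans is covered as many times as a product of
    face counts: the faces with given span whose closure contains a given
    face, and the unbounded faces with given span.  By Moebius inversion
    (Zaslavsky) both counts are the above numbers, as soon as one knows two
    Euler relations in every flat X: the sum of (-1)^(dim F) over the faces F
    contained in X is (-1)^(dim X), and over the bounded ones it is 1.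

    Both relations follow by inserting the hyperplanes one at a time.  The first
    weight, (-1)^dim, is preserved when a relatively open polyhedron is cut by a
    hyperplane.  So is the second one, which is (-1)^(dim - l) if the recession
    cone of the polyhedron is a linear space of dimension l, and 0 otherwise: it
    is 1 on a flat, and on the faces of an essential arrangement it is (-1)^dim
    if the face is bounded and 0 if not. *)

Set Implicit Arguments.
Unset Strict Implicit.
Unset Printing Implicit Defensive.
Import Order.TTheory GRing.Theory Num.Theory.
Local Open Scope ring_scope.

(** * Sums over chains *)

Section ChainSum.
Context (T : eqType) (lt : rel T) (rk : T -> nat) (E : seq T).
Hypothesis lt_trans : transitive lt.
Hypothesis lt_rk : forall x y, lt x y -> (rk x < rk y)%N.

Definition gap x y := (rk y - rk x).-1.

(** The extra 1 accounts for the rank of y itself, where a chain through y has the letter q. *)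
Lemma gapD x y z : lt x y -> lt y z -> gap x z = (gap x y + (gap y z).+1)%N.
Proof. by move=> /lt_rk xy /lt_rk yz; rewrite /gap; lia. Qed.

Section Ring.
Context (B : nzRingType) (p q : B).

(* The sum of p^.. q p^.. q ... q p^.. over the chains from x to y, the
   exponents being the gaps between the ranks; k bounds the length. *)
Fixpoint chain_sum_rec k x y : B := p ^+ gap x y +
  if k is k'.+1 then
    \sum_(z <- E | lt x z && lt z y) chain_sum_rec k' x z * q * p ^+ gap z y
  else 0.

Definition chain_sum x y := chain_sum_rec (rk y) x y.

(** Ranks strictly decrease along the recursion, so the fuel [rk y] never runs out; at rank 0 the
    sum is empty. *)
Lemma chain_sum_rec_fuel k j x y : (rk y <= k)%N -> (rk y <= j)%N ->
  chain_sum_rec k x y = chain_sum_rec j x y.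
Proof.
have sum0 F : rk y = 0%N -> \sum_(z <- E | lt x z && lt z y) F z = 0 :> B.
  by move=> y0; rewrite big1 // => z /andP[_ /lt_rk]; rewrite y0.
elim: k j y sum0 => [|k IHk] [|j] y sum0 //= yk yj.
- by rewrite sum0 //; apply/eqP; rewrite -leqn0.
- by rewrite sum0 //; apply/eqP; rewrite -leqn0.
congr (_ + _); apply: eq_bigr => z /andP[_ /lt_rk zy].
rewrite (IHk j) //; last 2 first.
- by rewrite -ltnS (leq_trans zy).
- by rewrite -ltnS (leq_trans zy).
by move=> F z0; rewrite big1 // => w /andP[_ /lt_rk]; rewrite z0.
Qed.

Lemma chain_sumE x y : chain_sum x y = p ^+ gap x y +
  \sum_(z <- E | lt x z && lt z y) chain_sum x z * q * p ^+ gap z y.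
Proof.
rewrite /chain_sum (@chain_sum_rec_fuel _ (rk y).+1) //=; congr (_ + _).
apply: eq_bigr => z /andP[_ /lt_rk zy].
by rewrite (@chain_sum_rec_fuel _ (rk z)) // ltnW.
Qed.

Lemma exchange_chain x y (F : T -> T -> B) :
  \sum_(z <- E | lt x z && lt z y) \sum_(u <- E | lt x u && lt u z) F u z =
  \sum_(u <- E | lt x u && lt u y) \sum_(z <- E | lt u z && lt z y) F u z.
Proof.
rewrite (exchange_big_dep (fun u => lt x u && lt u y)) /=; last first.
  by move=> z u /andP[_ zy] /andP[-> uz]; apply: lt_trans uz zy.
apply: eq_bigr => u /andP[xu uy]; apply: eq_bigl => z; rewrite xu /=.
by case uz: (lt u z); rewrite ?andbF ?andbT //= (lt_trans xu uz).
Qed.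

End Ring.

(* [mob x y] is (-1)^(rk y - rk x) times the Moebius function mu(x, y). *)
Definition mob : T -> T -> int := chain_sum (-1) 1.

Lemma mobE x y : mob x y = (-1) ^+ gap x y +
  \sum_(z <- E | lt x z && lt z y) mob x z * (-1) ^+ gap z y.
Proof.
rewrite /mob chain_sumE; congr (_ + _).
by apply: eq_bigr => z _; rewrite mulr1.
Qed.

(* For e = 1 this is Zaslavsky's count of the regions of a central arrangement;
   e = -1 subtracts from all regions of an affine one those that are bounded. *)
Definition zas (e : int) x y : int :=
  1 + \sum_(z <- E | lt x z && lt z y) mob x z + e * mob x y.

(** Weight the relation at w by [mob x w], sum over the w between x and y, and add the relation at
    x. By the recursion [mobE] all terms in n cancel except n x, and the right-hand sides add up to
    [zas]. *)
Lemma mob_inversion (e : int) (n : T -> int) x y : lt x y ->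
  (forall w, (w = x) \/ (w \in E) -> lt w y ->
     n w - \sum_(z <- E | lt w z && lt z y) (-1) ^+ gap w z * n z =
     1 + e * (-1) ^+ gap w y) ->
  n x = zas e x y.
Proof.
move=> xy H; have Hx := H x (or_introl erefl) xy.
have : \sum_(w <- E | lt x w && lt w y) mob x w *
    (n w - \sum_(z <- E | lt w z && lt z y) (-1) ^+ gap w z * n z) =
    \sum_(w <- E | lt x w && lt w y) mob x w * (1 + e * (-1) ^+ gap w y).
  rewrite big_seq_cond [RHS]big_seq_cond; apply: eq_bigr => w.
  by case/and3P=> wE _ wy; rewrite H //; right.
under eq_bigr do rewrite mulrBr mulr_sumr.
rewrite sumrB -exchange_chain -sumrB.
under [X in _ = X -> _]eq_bigr do rewrite mulrDr mulr1 mulrCA.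
rewrite [X in _ = X -> _]big_split /= -mulr_sumr.
have mobE' z : \sum_(w <- E | lt x w && lt w z) mob x w * (-1) ^+ gap w z =
    mob x z - (-1) ^+ gap x z by rewrite [in RHS]mobE addrC addKr.
rewrite mobE' => Hs; rewrite /zas.
have : \sum_(z <- E | lt x z && lt z y) (mob x z * n z -
   \sum_(w <- E | lt x w && lt w z) mob x w * ((-1) ^+ gap w z * n z)) =
   \sum_(z <- E | lt x z && lt z y) (-1) ^+ gap x z * n z.
  apply: eq_bigr => z _; under eq_bigr do rewrite mulrA.
  by rewrite -mulr_suml mobE' mulrBl opprB addrC subrK.
rewrite Hs => Hs'; move: Hx; rewrite -Hs' => /eqP; rewrite subr_eq => /eqP ->.
by rewrite mulrBr addrACA [X in _ + X = _]addrC subrK.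
Qed.

End ChainSum.

(** * Linear functionals on ab-polynomials *)

(* A stands for Z<a,b>, and L f for the linear extension of f. *)
Section WordAlgebra.
Context (A : nzRingType) (mon : seq bool -> A).
Context (L : (seq bool -> A) -> A -> A).
Hypothesis mon_nil : mon [::] = 1.
Hypothesis monM : forall s t, mon s * mon t = mon (s ++ t).
Hypothesis mon_ind : forall P : A -> Prop, (forall s, P (mon s)) -> P 0 ->
  (forall u v, P u -> P v -> P (u - v)) -> forall v, P v.
Hypothesis L_mon : forall f s, L f (mon s) = f s.
Hypothesis LB : forall f u v, L f (u - v) = L f u - L f v.

Local Notation a := (mon [:: false]).
Local Notation b := (mon [:: true]).
Local Notation c := (a - b).

Lemma L0 f : L f 0 = 0.
Proof. by rewrite -[X in L f X](subrr 0) LB subrr. Qed.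

Lemma LN f u : L f (- u) = - L f u.
Proof. by rewrite -sub0r LB L0 sub0r. Qed.

Lemma LD f u v : L f (u + v) = L f u + L f v.
Proof. by rewrite -[v in LHS]opprK LB LN opprK. Qed.

Lemma L_sum f (I : Type) (r : seq I) (P : pred I) (F : I -> A) :
  L f (\sum_(i <- r | P i) F i) = \sum_(i <- r | P i) L f (F i).
Proof. by apply: (big_morph (L f)) => [u v|]; [exact: LD | exact: L0]. Qed.

Lemma eq_L f g : f =1 g -> L f =1 L g.
Proof.
move=> fg; apply: mon_ind => [s||u v IHu IHv]; rewrite ?L_mon ?L0 //.
by rewrite !LB IHu IHv.
Qed.

Lemma L_add f g v : L (fun s => f s + g s) v = L f v + L g v.
Proof.
elim/mon_ind: v => [s||u v IHu IHv]; rewrite ?L_mon ?L0 ?addr0 //.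
by rewrite !LB IHu IHv opprD addrACA.
Qed.

Lemma L_sub f g v : L (fun s => f s - g s) v = L f v - L g v.
Proof.
elim/mon_ind: v => [s||u v IHu IHv]; rewrite ?L_mon ?L0 ?subr0 //.
by rewrite !LB IHu IHv !opprD !opprK addrACA.
Qed.

Lemma L_mull x f v : L (fun s => x * f s) v = x * L f v.
Proof.
elim/mon_ind: v => [s||u v IHu IHv]; rewrite ?L_mon ?L0 ?mulr0 //.
by rewrite !LB IHu IHv mulrBr.
Qed.

Lemma L_mulr f g x y :
  (forall s, L f (mon s * x) = g s * y) -> forall v, L f (v * x) = L g v * y.
Proof.
move=> fg v; elim/mon_ind: v => [s||u v IHu IHv]; rewrite ?mul0r ?L0 ?mul0r //.
  by rewrite fg L_mon.
by rewrite mulrBl !LB IHu IHv mulrBl.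
Qed.

Definition wkappa s := if all (pred1 false) s then c ^+ size s else 0.
Definition wbeta s := if all (pred1 true) s then c ^+ size s else 0.
Definition weta s :=
  if s == nseq (count_mem true s) true ++ nseq (count_mem false s) false
  then 2 * c ^+ size s else 0.
Definition wlambda s := weta s - 2 * wbeta s.

Lemma weta_rcons_a s : weta (rcons s false) = weta s * c.
Proof.
rewrite /weta size_rcons -cats1 !count_cat /= addn1 !addn0.
have -> k : nseq k.+1 false = rcons (nseq k false) false.
  by rewrite -addn1 nseqD cats1.
rewrite -rcons_cat cats1 eqseq_rcons eqxx andbT.
by case: ifP => _; [rewrite exprSr mulrA | rewrite mul0r].
Qed.

(** After a final b the shape b^m a^k leaves no room for an a, so only words in b alone survive;
    this is how beta enters. *)
Lemma weta_rcons_b s : weta (rcons s true) = 2 * wbeta s * c.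
Proof.
rewrite /wbeta /weta size_rcons -cats1 !count_cat /= addn0 addn1 !addn0.
have -> : (s ++ [:: true] == nseq (count_mem true s).+1 true ++
    nseq (count_mem false s) false) = all (pred1 true) s.
  case: (boolP (all (pred1 true) s)) => [sT|].
    have -> : count_mem false s = 0%N.
      apply/eqP; rewrite -leqn0 leqNgt -has_count; apply/negP.
      by case/hasP=> x /(allP sT) /eqP -> .
    rewrite cats0 -addn1 nseqD (all_pred1P _ _ sT) count_nseq /= mul1n.
    by rewrite eqxx.
  rewrite all_count => sF; have : (0 < count_mem false s)%N.
    rewrite lt0n; apply: contra sF => /eqP s0.
    have := count_predC (pred1 true) s.
    rewrite (@eq_count _ (predC _) (pred1 false)); last by case.
    by rewrite s0 addn0 => ->.
  case: (count_mem false s) => // k _; apply/negbTE/eqP.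
  rewrite -[k.+1]addn1 nseqD catA !cats1 => /eqP.
  by rewrite eqseq_rcons andbF.
by case: ifP => _; [rewrite exprSr mulrA | rewrite mulr0 mul0r].
Qed.

Lemma kappaMb v : L wkappa (v * b) = 0.
Proof.
rewrite (@L_mulr _ wkappa _ 0) ?mulr0 // => s.
by rewrite monM L_mon /wkappa cats1 all_rcons mulr0.
Qed.

Lemma kappaMa v : L wkappa (v * a) = L wkappa v * c.
Proof.
apply: L_mulr => s; rewrite monM L_mon /wkappa cats1 all_rcons /=.
by rewrite size_rcons exprSr; case: ifP; rewrite ?mul0r.
Qed.

Lemma betaMb v : L wbeta (v * b) = L wbeta v * c.
Proof.
apply: L_mulr => s; rewrite monM L_mon /wbeta cats1 all_rcons /=.
by rewrite size_rcons exprSr; case: ifP; rewrite ?mul0r.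
Qed.

Lemma betaMa v : L wbeta (v * a) = 0.
Proof.
rewrite (@L_mulr _ wbeta _ 0) ?mulr0 // => s.
by rewrite monM L_mon /wbeta cats1 all_rcons mulr0.
Qed.

Lemma etaMa v : L weta (v * a) = L weta v * c.
Proof. by apply: L_mulr => s; rewrite monM L_mon cats1 weta_rcons_a. Qed.

Lemma etaMb v : L weta (v * b) = 2 * L wbeta v * c.
Proof.
rewrite -L_mull; apply: L_mulr => s.
by rewrite monM L_mon cats1 weta_rcons_b.
Qed.

Lemma kappaMc v m : L wkappa (v * c ^+ m) = L wkappa v * c ^+ m.
Proof.
elim: m => [|m IHm]; first by rewrite !mulr1.
by rewrite exprSr !mulrA mulrBr LB kappaMa kappaMb subr0 IHm.
Qed.

(** Since beta kills words ending in a, a final factor c = a - b counts as -b. This is the source of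
    the signs of the Moebius function. *)
Lemma betaMc v m : L wbeta (v * c ^+ m) = (-1) ^+ m * L wbeta v * c ^+ m.
Proof.
elim: m => [|m IHm]; first by rewrite !expr0 mul1r !mulr1.
rewrite !exprSr !mulrA mulrBr LB betaMa betaMb sub0r IHm.
by rewrite mulrN1 !mulNr.
Qed.

(** Induction from eta(w c) = (eta(w) - 2 beta(w)) c: the term 1 comes from the final letters a, the
    alternating one from the beta terms. *)
Lemma etaMbc v m :
  L weta (v * b * c ^+ m) = (1 + (-1) ^+ m) * L wbeta v * c ^+ m.+1.
Proof.
elim: m => [|m IHm].
  by rewrite !expr0 mulr1 etaMb expr1; congr (_ * _ * _); rewrite mulr2n.
rewrite [c ^+ m.+1]exprSr mulrA mulrBr LB etaMa etaMb IHm betaMc betaMb.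
have -> : (-1) ^+ m * (L wbeta v * c) * c ^+ m =
    (-1) ^+ m * L wbeta v * c ^+ m.+1 by rewrite exprS !mulrA.
rewrite -mulrBl [2 * _]mulrA -mulrBl [2 * _]mulrA -mulrBl.
rewrite [c ^+ m.+2]exprSr [RHS]mulrA; congr (_ * _ * _ * _).
by rewrite mulr_natl mulr2n opprD addrA addrK exprS mulN1r.
Qed.

Lemma L_c_pow f m : L f (c ^+ m) = L f (mon [::] * c ^+ m).
Proof. by rewrite mon_nil mul1r. Qed.

Lemma kappac m : L wkappa (c ^+ m) = c ^+ m.
Proof. by rewrite L_c_pow kappaMc L_mon mul1r. Qed.

Lemma betac m : L wbeta (c ^+ m) = (-1) ^+ m * c ^+ m.
Proof. by rewrite L_c_pow betaMc L_mon mulr1. Qed.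

Lemma etac m : L weta (c ^+ m) = (1 + (-1) ^+ m) * c ^+ m.
Proof.
elim: m => [|m IHm].
  by rewrite !expr0 -mon_nil L_mon /weta /= mulr1 mon_nil mulr1.
rewrite exprSr [in LHS]mulrBr LB etaMa etaMb IHm betac.
rewrite -mulrBl [2 * _]mulrA -mulrBl [RHS]mulrA; congr (_ * _ * _).
by rewrite mulr_natl mulr2n opprD addrA addrK exprS mulN1r.
Qed.

(* [conv f g v] is the sum of f(v_(1)) g(v_(2)) in Sweedler notation. *)
Definition conv (f g : seq bool -> A) s :=
  \sum_(i < size s) f (take i s) * g (drop i.+1 s).

Lemma conv_rcons f g s x :
  conv f g (rcons s x) = conv f (fun t => g (rcons t x)) s + f s * g [::].
Proof.
rewrite /conv size_rcons big_ord_recr /= drop_oversize ?size_rcons //.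
rewrite -cats1 take_size_cat //; congr (_ + _); apply: eq_bigr => i _.
by rewrite takel_cat ?(ltnW (ltn_ord i)) // cats1 drop_rcons ?ltn_ord.
Qed.

Lemma convMmon f g v x : L (conv f g) (v * mon [:: x]) =
  L (conv f (fun t => g (rcons t x))) v + L f v * g [::].
Proof.
elim/mon_ind: v => [s||u v IHu IHv].
- by rewrite monM !L_mon cats1 conv_rcons.
- by rewrite !(mul0r, L0) addr0.
- by rewrite !mulrBl !LB IHu IHv mulrBl opprD addrACA.
Qed.

Lemma conv_subr f g h s : conv f (fun t => g t - h t) s = conv f g s - conv f
  h s.
Proof. by rewrite /conv -sumrB; apply: eq_bigr => i _; rewrite mulrBr. Qed.

(** The cut at the last letter gives the same term for a and for b, so c = a - b admits no cut, and
    right multiplication by c acts on the second tensor factor alone. *)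
Lemma convMc f g v m :
  L (conv f g) (v * c ^+ m) = L (conv f (fun t => L g (mon t * c ^+ m))) v.
Proof.
elim: m g => [|m IHm] g.
  by rewrite mulr1; apply: eq_L => s; apply: eq_bigr => i _; rewrite mulr1
    L_mon.
rewrite exprSr mulrA mulrBr LB !convMmon opprD addrACA subrr addr0.
rewrite -L_sub -(eq_L (fun s => conv_subr _ _ _ s)) IHm.
apply: eq_L => s; apply: eq_bigr => i _; congr (_ * _).
rewrite mulrA mulrBr LB L_sub; congr (_ - _); move: (_ * _) => w.
  by elim/mon_ind: w => [t||u w IHu IHw];
    rewrite ?mul0r ?L0 ?monM ?L_mon ?cats1 // mulrBl !LB IHu IHw.
by elim/mon_ind: w => [t||u w IHu IHw];
  rewrite ?mul0r ?L0 ?monM ?L_mon ?cats1 // mulrBl !LB IHu IHw.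
Qed.

Lemma convMbc f g v m :
  L (conv f g) (v * b * c ^+ m) =
  L (conv f (fun t => L g (mon t * b * c ^+ m))) v + L f v * L g (c ^+ m).
Proof.
rewrite convMc convMmon L_c_pow; congr (_ + _); apply: eq_L => s.
by apply: eq_bigr => i _; rewrite monM cats1.
Qed.

Lemma eq_conv f f' g s : (forall t, (size t < size s)%N -> f t = f' t) ->
  conv f g s = conv f' g s.
Proof.
move=> ff; apply: eq_bigr => i _.
by rewrite ff // size_take_min (leq_ltn_trans (geq_minl _ _)).
Qed.

(* The sum of the maps phi_ub,k with the last factor lambda_ub replaced by eta;
   k bounds the length of the word. *)
Fixpoint wpsi_rec k s := wkappa s +
  if k is k'.+1 then conv (wpsi_rec k') (fun t => b * weta t) s else 0.

Definition wpsi s := wpsi_rec (size s) s.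

Lemma wpsi_rec_fuel k j s : (size s <= k)%N -> (size s <= j)%N ->
  wpsi_rec k s = wpsi_rec j s.
Proof.
elim: k j s => [|k IHk] [|j] s //=.
- by rewrite leqn0 => /nilP -> _; rewrite /conv big_ord0.
- by move=> _; rewrite leqn0 => /nilP ->; rewrite /conv big_ord0.
move=> sk sj; congr (_ + _); apply: eq_conv => t ts.
by apply: IHk; rewrite -ltnS (leq_trans ts).
Qed.

Lemma wpsiE s : wpsi s = wkappa s + conv wpsi (fun t => b * weta t) s.
Proof.
rewrite /wpsi (@wpsi_rec_fuel _ (size s).+1) //=; congr (_ + _).
by apply: eq_conv => t ts; apply: wpsi_rec_fuel => //; apply: ltnW.
Qed.

(** The word form of phi_ub: kappa is the term k = 1, and the convolution gathers all k >= 2 by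
    their last factor. *)
Definition wphi s := wkappa s + conv wpsi (fun t => b * wlambda t) s.

(** * Values of the functionals on chain sums *)

Section Chains.
Context (T : eqType) (lt : rel T) (rk : T -> nat) (E : seq T).
Hypothesis lt_trans : transitive lt.
Hypothesis lt_rk : forall x y, lt x y -> (rk x < rk y)%N.
Local Notation chains := (chain_sum lt rk E c b).
Local Notation mob := (mob lt rk E).
Local Notation zas := (zas lt rk E).
Local Notation gap := (gap rk).

(* The ab-index of a poset is a coalgebra homomorphism. *)
Lemma conv_chains f g x y : L (conv f g) (chains x y) =
  \sum_(z <- E | lt x z && lt z y) L f (chains x z) * L g (chains z y).
Proof.
have [m] := ubnP (rk y); elim: m y g => // m IHm y g; rewrite ltnS => ym.
have convc k h : L (conv f h) (c ^+ k) = 0.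
  by rewrite L_c_pow convMc L_mon /conv big_ord0.
have shift h k v : L (fun t => L h (mon t * b * c ^+ k)) v = L h (v * b * c ^+
  k).
  elim/mon_ind: v => [t||u v IHu IHv]; rewrite ?L_mon ?mul0r ?L0 //.
  by rewrite !mulrBl !LB IHu IHv.
rewrite chain_sumE // LD convc add0r L_sum.
(* With z the last element of the chain, the cut falls either at the letter of z or at an earlier
   one, where the induction hypothesis applies. Regrouping by the element u at the cut rebuilds the
   chain sums from u to y. *)
under eq_bigr do rewrite convMbc.
rewrite big_split /=.
under [X in X + _]eq_bigr => z /andP[xz zy].
  rewrite IHm; last by rewrite (leq_trans (lt_rk zy)).
  under eq_bigr do rewrite shift.
  over.
rewrite exchange_chain // -big_split; apply: eq_bigr => u /andP[xu uy] /=.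
by rewrite [chains u y]chain_sumE // LD L_sum mulrDr addrC mulr_sumr.
Qed.

(** Every nonempty chain contributes a letter b, which kappa kills; only the empty chain
    survives. *)
Lemma kappa_chains x y : L wkappa (chains x y) = c ^+ gap x y.
Proof.
rewrite chain_sumE // LD kappac L_sum big1 ?addr0 // => z _.
by rewrite kappaMc kappaMb mul0r.
Qed.

(** Each c after the last b costs a sign, so splitting at the last element of the chain yields the
    recursion [mobE]. *)
Lemma beta_chains x y : lt x y ->
  L wbeta (chains x y) = (mob x y)%:~R * c ^+ gap x y.
Proof.
have [m] := ubnP (rk y); elim: m y => // m IHm y; rewrite ltnS => ym xy.
rewrite mobE // chain_sumE // LD L_sum betac rmorphD /= mulrDl; congr (_ + _).
  by rewrite rmorphXn /= mulrN1z.
rewrite rmorph_sum mulr_suml; apply: eq_bigr => z /andP[xz zy].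
rewrite betaMc betaMb IHm //; last by rewrite (leq_trans (lt_rk zy)).
rewrite rmorphM rmorphXn /= mulrN1z (gapD lt_rk xz zy) exprD exprS.
by rewrite !mulrA [_%:~R * _]commr_sign.
Qed.

(** Split at the last element z, the value carries 1 + (-1)^(gap z y) times [mob x z]: the 1 gives
    the plain sum in [zas], and the sign rebuilds [mob x y]. *)
Lemma eta_chains x y : lt x y ->
  L weta (chains x y) = (zas 1 x y)%:~R * c ^+ gap x y.
Proof.
move=> xy; rewrite /zas mul1r chain_sumE // LD L_sum etac.
rewrite [mob x y]mobE // addrACA -big_split /=.
rewrite [in RHS]rmorphD [RHS]mulrDl; congr (_ + _).
  by rewrite rmorphD rmorphXn /= mulrN1z.
rewrite rmorph_sum mulr_suml; apply: eq_bigr => z /andP[xz zy].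
rewrite etaMbc beta_chains // -[X in X + _ * _]mulr1 -mulrDr.
rewrite rmorphM rmorphD rmorphXn /= mulrN1z (gapD lt_rk xz zy) exprD.
rewrite !mulrA; congr (_ * _ * _); rewrite mulrDl mulrDr mul1r mulr1.
by rewrite commr_sign.
Qed.

Lemma lambda_chains x y : lt x y ->
  L wlambda (chains x y) = (zas (-1) x y)%:~R * c ^+ gap x y.
Proof.
move=> xy; rewrite /wlambda L_sub L_mull eta_chains // beta_chains //.
rewrite mulrA -mulrBl; congr (_ * _); rewrite /zas mul1r mulN1r.
by rewrite -[2]/(2%:~R) -rmorphM -rmorphB /=; congr _%:~R; lia.
Qed.

Lemma psi_chains x y : L wpsi (chains x y) = c ^+ gap x y +
  \sum_(z <- E | lt x z && lt z y)
    (L wpsi (chains x z) * b * c ^+ gap z y) *~ zas 1 z y.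
Proof.
rewrite (eq_L wpsiE) L_add kappa_chains conv_chains; congr (_ + _).
apply: eq_bigr => z /andP[xz zy]; rewrite L_mull eta_chains //.
by rewrite mulrzl !mulrzAr mulrA.
Qed.

Lemma phi_chains x y : L wphi (chains x y) = c ^+ gap x y +
  \sum_(z <- E | lt x z && lt z y)
    (L wpsi (chains x z) * b * c ^+ gap z y) *~ zas (-1) z y.
Proof.
rewrite /wphi L_add kappa_chains conv_chains; congr (_ + _).
apply: eq_bigr => z /andP[xz zy]; rewrite L_mull lambda_chains //.
by rewrite mulrzl !mulrzAr mulrA.
Qed.

End Chains.

(** * Comparing two posets along a rank-preserving map *)

Section Transfer.
Context (TP TQ : eqType) (ltP : rel TP) (ltQ : rel TQ).
Context (rkP : TP -> nat) (rkQ : TQ -> nat) (EP : seq TP) (EQ : seq TQ).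
Context (sp : TQ -> TP) (botP topP : TP) (botQ topQ : TQ).
Hypothesis ltP_trans : transitive ltP.
Hypothesis ltQ_trans : transitive ltQ.
Hypothesis ltP_rk : forall x y, ltP x y -> (rkP x < rkP y)%N.
Hypothesis ltQ_rk : forall x y, ltQ x y -> (rkQ x < rkQ y)%N.
Hypothesis uniqP : uniq EP.
Hypothesis sp_in : forall F, F \in EQ -> sp F \in EP.
Hypothesis sp_rk : forall F, F \in EQ -> rkP (sp F) = rkQ F.
Hypothesis sp_lt : forall F G,
  F \in EQ -> G \in EQ -> ltQ F G -> ltP (sp F) (sp G).
Hypothesis bot_rk : rkP botP = rkQ botQ.
Hypothesis top_rk : rkP topP = rkQ topQ.
Hypothesis botP_lt : forall x, x \in EP -> ltP botP x.
Hypothesis topP_lt : forall x, x \in EP -> ltP x topP.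
Hypothesis botQ_lt : forall F, F \in EQ -> ltQ botQ F.
Hypothesis topQ_lt : forall F, F \in EQ -> ltQ F topQ.
Hypothesis count_below : forall x G, x \in EP -> G \in EQ -> ltP x (sp G) ->
  (count (fun F => ltQ F G && (sp F == x)) EQ)%:Z = zas ltP rkP EP 1 x (sp G).
Hypothesis count_all : forall x, x \in EP ->
  (count (fun F => sp F == x) EQ)%:Z = zas ltP rkP EP (-1) x topP.

Lemma sum_over_fibers (h : TP -> A) (p : pred TQ) :
  \sum_(F <- EQ | p F) h (sp F) =
  \sum_(x <- EP) h x *~ (count (fun F => p F && (sp F == x)) EQ).
Proof.
rewrite big_seq_cond.
under eq_bigr => F /andP[/sp_in spF _].
  rewrite -(big_seq1 +%R (sp F) h) -(filter_pred1_uniq uniqP spF) big_filter.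
  over.
rewrite -big_seq_cond (exchange_big_dep predT) //=; apply: eq_bigr => x _.
rewrite big_const_seq iter_addr_0 pmulrn; congr (_ *~ Posz _).
by apply: eq_count => F /=; rewrite eq_sym.
Qed.

(** Induction on the rank of G. Both sides are expanded at the last element of the chain; the
    elements F below G are grouped by [sp F], and [count_below] turns the fibre sizes into the
    coefficients of [psi_chains]. *)
Lemma chains_span G : G \in EQ ->
  chain_sum ltQ rkQ EQ c b botQ G =
  L wpsi (chain_sum ltP rkP EP c b botP (sp G)).
Proof.
have [m] := ubnP (rkQ G); elim: m G => // m IHm G; rewrite ltnS => Gm GE.
rewrite chain_sumE // psi_chains //; congr (_ + _).
  by rewrite /gap sp_rk // bot_rk.
pose h x := L wpsi (chain_sum ltP rkP EP c b botP x) * b *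
  c ^+ gap rkP x (sp G).
transitivity (\sum_(F <- EQ | ltQ F G) h (sp F)).
  rewrite big_seq_cond [RHS]big_seq_cond.
  under eq_bigl => F do rewrite andbA.
  rewrite (eq_bigl (fun F => (F \in EQ) && ltQ F G)); last first.
    by move=> F; case FE: (F \in EQ); rewrite //= botQ_lt.
  apply: eq_bigr => F /andP[FE FG].
  rewrite /h -IHm // ?(leq_trans (ltQ_rk FG)) //.
  by rewrite /gap !sp_rk.
rewrite sum_over_fibers big_seq [RHS]big_seq_cond.
rewrite (bigID (fun x => ltP x (sp G))) /= [X in _ + X]big1 ?addr0.
  rewrite (eq_bigl (fun i => (i \in EP) && (ltP botP i && ltP i (sp G)))).
    by apply: eq_bigr => x /and3P[xE _ xG]; rewrite count_below.
  by move=> x; case xE: (x \in EP); rewrite //= botP_lt.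
(* Fibres over elements not below [sp G] are empty, because [sp] is strictly monotone. *)
move=> x /andP[xE xG]; rewrite (@eq_in_count _ _ pred0) ?count_pred0 //.
by move=> F FE /=; apply/negbTE; apply: contraNN xG => /andP[/sp_lt + /eqP
  <-]; apply.
Qed.

(** The argument of [chains_span] for the top element, where the fibres are counted by [count_all];
    hence lambda_ub replaces eta in the last factor only. *)
Lemma transfer_phi :
  chain_sum ltQ rkQ EQ c b botQ topQ =
  L wphi (chain_sum ltP rkP EP c b botP topP).
Proof.
rewrite chain_sumE // phi_chains //; congr (_ + _).
  by rewrite /gap top_rk bot_rk.
pose h x := L wpsi (chain_sum ltP rkP EP c b botP x) * b *
  c ^+ gap rkP x topP.
transitivity (\sum_(F <- EQ | true) h (sp F)).
  rewrite big_seq_cond [RHS]big_seq_cond.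
  rewrite (eq_bigl (fun F => (F \in EQ) && true)); last first.
    by move=> F; case FE: (F \in EQ); rewrite //= botQ_lt ?topQ_lt.
  apply: eq_bigr => F /andP[FE _].
  by rewrite /h -chains_span // /gap sp_rk // top_rk.
rewrite sum_over_fibers big_seq [RHS]big_seq_cond.
rewrite (eq_bigl (fun i => (i \in EP) && (ltP botP i && ltP i topP))).
  by apply: eq_bigr => x /and3P[xE _ xG] /=; rewrite count_all.
by move=> x; case xE: (x \in EP); rewrite //= botP_lt ?topP_lt.
Qed.

End Transfer.

End WordAlgebra.

(** * The map phi_ub *)

(** The index set of [linext] depends on v; a common larger one makes additivity visible. *)
Lemma linextEw (K : choiceType) (M : zmodType) (f : K -> M) (d : {fset K})
    (v : {malg int[K]}) :
  (msupp v `<=` d)%fset -> linext f v = \sum_(k <- d) f k *~ v@_k.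
Proof.
move=> le; rewrite /linext (big_fset_incl _ le) //= => x _ /mcoeff_outdom ->.
by rewrite mulr0z.
Qed.

Lemma linext_is_zmod_morphism (K : choiceType) (M : zmodType) (f : K -> M) :
  zmod_morphism (linext f).
Proof.
move=> u v; rewrite (@linextEw _ _ f (msupp u `|` msupp v)%fset (u - v)).
  rewrite (@linextEw _ _ f (msupp u `|` msupp v)%fset u) ?fsubsetUl //.
  rewrite (@linextEw _ _ f (msupp u `|` msupp v)%fset v) ?fsubsetUr //.
  by rewrite -sumrB; apply: eq_bigr => k _; rewrite mcoeffB mulrzBr.
exact: msuppB_le.
Qed.

HB.instance Definition _ (K : choiceType) (M : zmodType) (f : K -> M) :=
  GRing.isZmodMorphism.Build {malg int[K]} M (linext f)
    (linext_is_zmod_morphism f).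

Lemma linext0 (K : choiceType) (M : zmodType) (f : K -> M) :
  linext f 0 = 0.
Proof. exact: raddf0. Qed.

Lemma linextB (K : choiceType) (M : zmodType) (f : K -> M)
    (u v : {malg int[K]}) :
  linext f (u - v) = linext f u - linext f v.
Proof. exact: raddfB. Qed.

Lemma linext_sum (K : choiceType) (M : zmodType) (f : K -> M) (I : Type)
    (r : seq I) (P : pred I) (F : I -> {malg int[K]}) :
  linext f (\sum_(i <- r | P i) F i) = \sum_(i <- r | P i) linext f (F i).
Proof. exact: raddf_sum. Qed.

Lemma linextU (K : choiceType) (M : zmodType) (f : K -> M) (k : K) :
  linext f << k >> = f k.
Proof.
by rewrite (@linextEw _ _ _ [fset k]%fset) ?msuppU_le // big_seq_fset1 mcoeffUU.
Qed.

Lemma linext_mon (M : zmodType) (f : word -> M) (s : seq bool) :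
  linext f (mon s) = f (FMonom s).
Proof. exact: linextU. Qed.

Lemma malg_ind (K : choiceType) (P : {malg int[K]} -> Prop) :
  (forall k, P << k >>) -> P 0 -> (forall u v, P u -> P v -> P (u - v)) ->
  forall v, P v.
Proof.
move=> PU P0 PB v.
have PN u : P u -> P (- u) by rewrite -[- u]add0r; apply: PB.
have PD u w : P u -> P w -> P (u + w).
  by move=> Pu Pw; rewrite -[w]opprK; apply/PB/PN.
rewrite [v]monalgE; elim/big_ind: _ => // k _.
have Pn n : P << n%:Z *g k >>.
  elim: n => [|n IHn]; first by rewrite monalgU0.
  by rewrite -addn1 PoszD monalgUD; apply: PD.
by case: (v@_k) => n; rewrite ?NegzE ?monalgUN; [|apply: PN].
Qed.

Lemma Zab_ind (P : Zab -> Prop) :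
  (forall s, P (mon s)) -> P 0 -> (forall u v, P u -> P v -> P (u - v)) ->
  forall v, P v.
Proof. by move=> Pm; apply: malg_ind => -[s]; apply: Pm. Qed.

Lemma monM (s t : seq bool) : mon s * mon t = mon (s ++ t).
Proof.
by rewrite /mon malgM_def fgmulUU mul1r; congr << _ >>; exact: fmmulE.
Qed.

Lemma mon_nil : mon [::] = 1.
Proof. by rewrite /mon -fmoneE. Qed.

Lemma linext_comp (K K' : choiceType) (M : zmodType) (g : K' -> M)
    (h : K -> {malg int[K']}) (v : {malg int[K]}) :
  linext g (linext h v) = linext (fun k => linext g (h k)) v.
Proof.
elim/malg_ind: v => [k||u w IHu IHw]; first by rewrite !linextU.
  by rewrite !linext0.
by rewrite !linextB IHu IHw.
Qed.

(** * Iterated coproducts *)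

Section Sweedler.
Context (B : nzRingType) (f0 f1 f2 : word -> B).
Local Notation pre i w := (FMonom (take i (fmonom_val w))).
Local Notation suf i w := (FMonom (drop i.+1 (fmonom_val w))).
Local Notation v_ t j := (nth (FMonom [::]) t j).

Lemma linext_mulrC (K : choiceType) (f : K -> B) (x : B) (v : {malg int[K]}) :
  linext (fun t => f t * x) v = linext f v * x.
Proof.
elim/malg_ind: v => [k||u w IHu IHw]; first by rewrite !linextU.
  by rewrite !linext0 mul0r.
by rewrite !linextB IHu IHw mulrBl.
Qed.

(** The first coproduct taken is followed by further ones on its left factor only, so its right
    factor is the last tensor factor of the result and can be split off. *)
Lemma linext_coproduct_iter (g : seq word -> B) k (w : word) :
  linext g (coproduct_iter k.+1 w) =
  \sum_(i < size w)
    linext (fun t => g (rcons t (suf i w))) (coproduct_iter k (pre i w)).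
Proof.
rewrite [coproduct_iter _ _]/= linext_comp /coproduct linext_sum.
apply: eq_bigr => i _; rewrite linextU /= linext_comp.
by apply: eq_bigr => t _; rewrite linextU cats1.
Qed.

(** Only tuples of length k + 1 occur in the iterated coproduct. *)
Lemma eq_linext_coproduct_iter (f g : seq word -> B) k (w : word) :
  (forall t, size t = k.+1 -> f t = g t) ->
  linext f (coproduct_iter k w) = linext g (coproduct_iter k w).
Proof.
elim: k f g w => [|k IHk] f g w fg; first by rewrite !linextU fg.
rewrite !linext_coproduct_iter; apply: eq_bigr => i _.
by apply: IHk => t tk; rewrite fg // size_rcons tk.
Qed.

(** With kappa for f0 and b eta for f1, this is the part of [wpsi] that comes from k + 1 tensor
    factors. *)
Definition sweedler_psi k (w : word) : B :=
  linext (fun t => f0 (v_ t 0) * \prod_(1 <= j < k.+1) f1 (v_ t j))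
    (coproduct_iter k w).

Lemma sweedler_last k (w : word) :
  linext (fun t => f0 (v_ t 0) * (\prod_(1 <= j < k.+1) f1 (v_ t j))
                   * f2 (v_ t k.+1)) (coproduct_iter k.+1 w) =
  \sum_(i < size w) sweedler_psi k (pre i w) * f2 (suf i w).
Proof.
rewrite linext_coproduct_iter; apply: eq_bigr => i _.
rewrite -linext_mulrC; apply: eq_linext_coproduct_iter => t tk.
rewrite !nth_rcons tk /= ltnn eqxx; congr (_ * _ * _).
by apply: eq_big_nat => j /andP[_ jk]; rewrite nth_rcons tk jk.
Qed.

Lemma sweedler_psi0 w : sweedler_psi 0 w = f0 w.
Proof. by rewrite /sweedler_psi linextU big_geq // mulr1. Qed.

End Sweedler.

Lemma sweedler_psiS (B : nzRingType) (f0 f1 : word -> B) k (w : word) :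
  sweedler_psi f0 f1 k.+1 w =
  \sum_(i < size w) sweedler_psi f0 f1 k (FMonom (take i w))
    * f1 (FMonom (drop i.+1 w)).
Proof.
rewrite -sweedler_last /sweedler_psi; apply: eq_bigr => t _.
by rewrite big_nat_recr //= mulrA.
Qed.

(** Splitting off the last factor of all terms with k > 0 leaves the same sum on proper prefixes, so
    the sum satisfies the recursion of p. *)
Lemma sum_sweedler_psi (B : nzRingType) (f0 f1 : word -> B) (p : seq bool ->
  B) :
  (forall s, p s = f0 (FMonom s) + conv p (fun t => f1 (FMonom t)) s) ->
  forall m (w : word), (size w < m)%N ->
  \sum_(k < m) sweedler_psi f0 f1 k w = p w.
Proof.
move=> pE; elim=> // m IHm w wm; rewrite big_ord_recl sweedler_psi0 pE.
congr (_ + _); first by case: w {wm}.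
under eq_bigr => k _ do rewrite sweedler_psiS.
rewrite exchange_big; apply: eq_bigr => i _ /=; rewrite -mulr_suml IHm //=.
by rewrite size_take_min (leq_ltn_trans (geq_minl _ _)) // (leq_trans (ltn_ord
  i)).
Qed.

Lemma wkappaE s : kappa (FMonom s) = wkappa mon s.
Proof.
by rewrite /kappa /wkappa /=; congr (if _ then _ else _); apply/eqP/all_pred1P.
Qed.

Lemma wbetaE s : beta (FMonom s) = wbeta mon s.
Proof.
by rewrite /beta /wbeta /=; congr (if _ then _ else _); apply/eqP/all_pred1P.
Qed.

Lemma wlambdaE s : lambda_ub (FMonom s) = wlambda mon s.
Proof. by rewrite /lambda_ub /wlambda wbetaE. Qed.

Lemma eq_linext (K : choiceType) (M : zmodType) (f g : K -> M)
    (v : {malg int[K]}) : f =1 g -> linext f v = linext g v.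
Proof. by move=> fg; apply: eq_bigr => k _; rewrite fg. Qed.

Lemma phi_ub_word s :
  \sum_(1 <= k < (size s).+2) phi_ub_k k (FMonom s) = wphi mon s.
Proof.
rewrite big_nat_recl //= big_add1 big_mkord /wphi -wkappaE; congr (_ + _).
transitivity (\sum_(k < size s) \sum_(i < size s)
  sweedler_psi kappa (fun w => b * eta w) k (FMonom (take i s)) *
  (b * lambda_ub (FMonom (drop i.+1 s)))).
  by apply: eq_bigr => k _; exact: (sweedler_last kappa (fun w => b * eta w)
    (fun w => b * lambda_ub w) k (FMonom s)).
rewrite exchange_big; apply: eq_bigr => i _ /=; rewrite -mulr_suml wlambdaE.
rewrite (@sum_sweedler_psi _ _ _ (wpsi mon)) //=; last first.
  by rewrite size_take_min (leq_ltn_trans (geq_minl _ _)).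
by move=> t; rewrite wpsiE wkappaE.
Qed.

Lemma phi_ubE v : phi_ub v = linext (fun w : word => wphi mon w) v.
Proof. by apply: eq_linext => -[s]; exact: phi_ub_word. Qed.

(** * The ab-index as a sum over chains *)

Lemma prod_mon (A : nzRingType) (mon : seq bool -> A) (I : finType)
    (S U : {set I}) (l : seq I) :
  mon [::] = 1 -> (forall s t, mon s * mon t = mon (s ++ t)) ->
  \prod_(i <- l) (if i \in U then if i \in S then mon [:: true] else 0
                  else if i \in S then - mon [:: true] else mon [:: false]) =
  if all (fun i => (i \in U) ==> (i \in S)) l
  then mon [seq i \in S | i <- l] *~ (-1) ^+ count (mem (S :\: U)) l else 0.
Proof.
move=> mon_nil monM; elim: l => [|i l IHl] /=.
  by rewrite big_nil expr0 mulr1z mon_nil.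
rewrite big_cons IHl inE; case: (i \in U) => /=; case: (i \in S) => /=.
- by case: ifP => _; rewrite ?mulr0 // add0n mulrzAr monM.
- by rewrite mul0r.
- case: ifP => _; rewrite ?mulr0 // mulNr mulrzAr monM exprD expr1 mulN1r.
  by rewrite mulrNz.
- by case: ifP => _; rewrite ?mulr0 // add0n mulrzAr monM.
Qed.

(** Outside U the factor a - b contributes a or -b. S collects the positions where b is chosen,
    which gives the sign relating flag h to flag f. *)
Lemma prod_ab (A : nzRingType) (mon : seq bool -> A) (I : finType)
    (U : {set I}) :
  mon [::] = 1 -> (forall s t, mon s * mon t = mon (s ++ t)) ->
  \prod_i (if i \in U then mon [:: true] else mon [:: false] - mon [:: true]) =
  \sum_(S : {set I} | U \subset S)
     mon [seq i \in S | i <- enum I] *~ (-1) ^+ #|S :\: U|.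
Proof.
move=> mon_nil monM.
(* [F i e] is what position i contributes when the letter e is chosen there. *)
pose F i e := if i \in U then if e then mon [:: true] else 0
              else if e then - mon [:: true] else mon [:: false].
transitivity (\prod_i \sum_(e : bool) F i e).
  apply: eq_bigr => i _; rewrite big_bool /F /=.
  by case: (i \in U); [rewrite addr0 | rewrite addrC].
rewrite bigA_distr_bigA (reindex (fun S : {set I} => [ffun i => i \in S])) /=.
  rewrite [RHS]big_mkcond; apply: eq_bigr => S _.
  have -> : index_enum I = enum I by rewrite [index_enum I]unlock -enumT.
  under eq_bigr => i _ do rewrite ffunE.
  rewrite prod_mon // -size_filter.
  have -> : (all (fun i => (i \in U) ==> (i \in S)) (enum I)) = (U \subset S).
    apply/allP/subsetP => [H i iU|H i _]; last by apply/implyP/H.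
    by have := H i (mem_enum _ i); rewrite iU.
  by rewrite cardE enumT.
exists (fun f : {ffun I -> bool} => [set i | f i]) => [S _|f _].
  by apply/setP => i; rewrite inE ffunE.
by apply/ffunP => i; rewrite ffunE inE.
Qed.

Section AbIndex.
Context (P : ranked_poset) (E : seq (elt P)).
Local Notation bot := (pbot P).
Local Notation top := (ptop P).
Local Notation rk := (@prk P).

(* The strict order of P between elements of P only, [ple] being unconstrained
   outside the carrier. *)
Definition clt (x y : elt P) :=
  [&& x \in bot :: top :: E, y \in bot :: top :: E & plt x y].

Hypothesis uniqE : uniq E.
Hypothesis E_carrier : forall x, x \in E -> carrier x.
Hypothesis carrier_E : forall x, carrier x -> x \in bot :: top :: E.
Hypothesis clt_trans : transitive clt.
Hypothesis clt_rk : forall x y, clt x y -> (rk x < rk y)%N.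
Hypothesis bot_clt : forall x, x \in E -> clt bot x.
Hypothesis bot_top : clt bot top.
Hypothesis rk_bot : rk bot = 0%N.

Fixpoint chains_to k y : seq (seq (elt P)) := [::] ::
  if k is k'.+1 then
    [seq rcons s z | z <- [seq z <- E | clt bot z && clt z y],
                     s <- chains_to k' z]
  else [::].

Lemma rcons_chains_to k y s z :
  (rcons s z \in chains_to k.+1 y) =
  [&& z \in E, clt bot z, clt z y & s \in chains_to k z].
Proof.
rewrite /= inE; have -> /= : rcons s z == [::] = false by case: s.
apply/allpairsPdep/idP => [[z' [s' []]]|/and4P[zE bz zy sz]].
  rewrite mem_filter => /andP[/andP[bz zy] zE] sz /rcons_inj[-> ->].
  by rewrite bz zy zE.
by exists z, s; rewrite mem_filter bz zy zE.
Qed.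

Lemma chains_to_uniq k y : uniq (chains_to k y).
Proof.
elim: k y => //= k IHk y; apply/andP; split.
  by apply/allpairsPdep => -[z [[|x s] []]].
apply: allpairs_uniq_dep; first exact: filter_uniq.
  by move=> z _; apply: IHk.
by move=> [z s] [z' s'] _ _ /= /rcons_inj[-> ->].
Qed.

Lemma chains_to_rk k y s x : s \in chains_to k y -> x \in s ->
  (0 < rk x < rk y)%N.
Proof.
elim: k y s x => [|k IHk] y s x; first by rewrite inE => /eqP ->.
case/lastP: s => // s z; rewrite rcons_chains_to.
case/and4P=> _ /clt_rk bz /clt_rk zy sz.
rewrite mem_rcons inE => /orP[/eqP ->|xs]; first by rewrite zy -rk_bot bz.
by case/andP: (IHk _ _ _ sz xs) => -> xz; apply: ltn_trans xz zy.
Qed.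

Lemma mem_chains_to k y s : (rk y <= k)%N -> clt bot y ->
  (s \in chains_to k y) = path clt bot (rcons s y) && all (mem E) s.
Proof.
elim: k y s => [|k IHk] y s yk by_.
  by move: (clt_rk by_); rewrite leqn0 in yk; rewrite (eqP yk).
case/lastP: s => [|s z]; first by rewrite /= by_ inE.
rewrite rcons_chains_to all_rcons [path _ _ (rcons (rcons _ _) _)]rcons_path.
rewrite last_rcons /=; case zE: (z \in E) => //=; rewrite ?andbF //.
rewrite bot_clt //=; case zy: (clt z y) => //=; rewrite ?andbF //= andbT.
by rewrite IHk ?bot_clt // -ltnS (leq_trans (clt_rk zy)).
Qed.

Lemma mem_chains_to_top s : s \in chains_to (rk top) top ->
  path (@plt P) bot (rcons s top) /\ forall x, x \in s -> x \in E.
Proof.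
rewrite mem_chains_to // => /andP[ps /allP sE]; split=> //.
by apply: sub_path ps => x y /and3P[].
Qed.

(** The carrier contains bottom and top, but strictness of the chain keeps them out of its interior,
    so the interior lies in E. *)
Lemma chains_to_top s : path (@plt P) bot (rcons s top) ->
  (forall x, x \in s -> carrier x) -> s \in chains_to (rk top) top.
Proof.
move=> ps sC; rewrite mem_chains_to //.
have pc : path clt bot (rcons s top).
  apply: (sub_in_path (P := mem (bot :: top :: E))) ps.
    by move=> x y xC yC xy; rewrite /clt xC yC.
  apply/allP => x xs; suff : x \in bot :: top :: E by [].
  move: xs; rewrite inE mem_rcons inE.
  by case/or3P=> [/eqP->|/eqP->|/sC/carrier_E//]; rewrite !inE eqxx ?orbT.
rewrite pc /=; apply/allP => x xs.
have /carrier_E := sC x xs; rewrite !inE => /or3P[/eqP xb|/eqP xt|//].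
  move: pc; rewrite rcons_path (path_sortedE clt_trans).
  by case/andP => /andP[/allP/(_ x xs) /clt_rk]; rewrite xb ltnn.
have : sorted clt (rcons s top).
  by case: (s) pc => //= z t /andP[].
rewrite -rev_sorted rev_rcons /= path_sortedE; last first.
  by move=> u v w vu uw; apply: clt_trans uw vu.
by case/andP=> /allP/(_ x); rewrite mem_rev xt => /(_ _)/clt_rk; rewrite -xt
  xs ltnn => /(_ isT).
Qed.

Definition rank_set s : {set 'I_(ab_degree P)} :=
  [set i : 'I_(ab_degree P) | (nat_of_ord i).+1 \in [seq rk x | x <- s]].

Lemma flag_fE (U : {set 'I_(ab_degree P)}) :
  flag_f U = count (fun s => rank_set s == U) (chains_to (rk top) top).
Proof.
have chainsE s : chains U s <->
    (s \in chains_to (rk top) top) && (rank_set s == U).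
  split.
    move=> [sC ps sU]; apply/andP; split; first exact: chains_to_top.
    apply/eqP/setP => i; rewrite inE sU; apply/mapP/idP => [[j]|iU].
      by rewrite mem_enum => jU [] /val_inj ->.
    by exists i; rewrite ?mem_enum.
  case/andP => sch /eqP <-; have [ps sE] := mem_chains_to_top sch.
  split=> // [x /sE/E_carrier //|m].
  apply/idP/mapP => [/[dup] ms /mapP[x xs mx]|[i]]; last first.
    by rewrite mem_enum inE => + ->.
  have /andP[x0 xt] := chains_to_rk sch xs.
  have lt : (m.-1 < ab_degree P)%N by rewrite mx /ab_degree; lia.
  exists (Ordinal lt); last by rewrite /= prednK ?mx.
  by rewrite mem_enum inE /= prednK mx // -mx.
(* [fset_set] is faithful on finite sets only. *)
have fin : finite_set (chains U).
  apply: sub_finite_set (finite_seq (chains_to (rk top) top)) => t.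
  by move/chainsE/andP => -[].
rewrite /flag_f -size_filter; apply: perm_size; apply: uniq_perm.
- exact: fset_uniq.
- exact/filter_uniq/chains_to_uniq.
move=> s; rewrite mem_filter andbC in_fset_set //.
by apply/idP/idP => [|/chainsE]; rewrite in_setE // => /chainsE.
Qed.

Section Ring.
Context (A : nzRingType) (mon : seq bool -> A).
Hypothesis mon_nil : mon [::] = 1.
Hypothesis monM : forall s t, mon s * mon t = mon (s ++ t).
Local Notation b := (mon [:: true]).
Local Notation c := (mon [:: false] - mon [:: true]).

Definition weight r (s : seq (elt P)) : A :=
  \prod_(0 <= i < r) if i.+1 \in [seq rk x | x <- s] then b else c.

Lemma weight_rcons s z y : (forall x, x \in s -> 0 < rk x < rk z)%N ->
  (0 < rk z < rk y)%N ->
  weight (rk y).-1 (rcons s z) = weight (rk z).-1 s * b * c ^+ gap rk z y.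
Proof.
move=> sz /andP[z0 zy]; rewrite /weight.
rewrite (@big_cat_nat _ _ _ (rk z)) //=; last by rewrite -ltnS prednK //
  (leq_trans _ zy).
rewrite -{1}(prednK z0) big_nat_recr //=; congr (_ * _ * _).
- apply: eq_big_nat => i /andP[_ iz]; rewrite map_rcons mem_rcons inE.
  by rewrite eqn_leq [(rk z <= _)%N]leqNgt -{2}(prednK z0) ltnS iz andbF.
- by rewrite prednK // map_rcons mem_rcons inE eqxx.
rewrite (eq_big_nat _ _ (F2 := fun=> c)).
  by rewrite prodr_const_nat /gap; congr (_ ^+ _); lia.
move=> i /andP[iz _]; rewrite map_rcons mem_rcons inE gtn_eqF ?ltnS //=.
by case: mapP => // -[x /sz/andP[_ xz] ix]; move: xz; rewrite -ix ltnNge ltnW.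
Qed.

Lemma sum_weight k y : (rk y <= k)%N -> clt bot y ->
  \sum_(s <- chains_to k y) weight (rk y).-1 s = chain_sum clt rk E c b bot y.
Proof.
elim: k y => [|k IHk] y yk by_.
  by move: (clt_rk by_); rewrite leqn0 in yk; rewrite (eqP yk).
rewrite [chains_to _ _]/= big_cons chain_sumE //; congr (_ + _).
  by rewrite /weight prodr_const_nat /gap rk_bot !subn0.
rewrite big_allpairs_dep big_filter; apply: eq_bigr => z /andP[bz zy].
have zk : (rk z <= k)%N by rewrite -ltnS (leq_trans (clt_rk zy)).
rewrite -IHk // !mulr_suml big_seq [RHS]big_seq; apply: eq_bigr => s sz.
rewrite weight_rcons ?clt_rk ?andbT //; last by rewrite -rk_bot clt_rk.
by move=> x; apply: chains_to_rk sz.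
Qed.

(** Exchanging S and U turns the sum of h_S u_S into the sum of f_U times the word with b on U and a
    - b elsewhere. Each chain then contributes its own word, and the signs are absorbed in c. *)
Lemma ab_sum_chain_sum :
  \sum_(S : {set 'I_(ab_degree P)})
    mon [seq i \in S | i <- enum 'I_(ab_degree P)] *~ flag_h S =
  chain_sum clt rk E c b bot top.
Proof.
rewrite -(@sum_weight (rk top)) //.
transitivity (\sum_(U : {set 'I_(ab_degree P)})
   (\prod_i if i \in U then b else c) *~ flag_f U).
  under eq_bigr do rewrite /flag_h mulrz_sumr.
  rewrite (exchange_big_dep predT) //=; apply: eq_bigr => U _.
  rewrite prod_ab // mulrz_suml; apply: eq_bigr => S _.
  by rewrite mulrzA.
under eq_bigr => U _.
  rewrite flag_fE -pmulrn -iter_addr_0 -big_const_seq.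
  over.
rewrite (exchange_big_dep predT) //=; apply: eq_bigr => s _.
rewrite (eq_bigl (pred1 (rank_set s))) ?big_pred1_eq; last first.
  by move=> U; rewrite /= eq_sym.
by rewrite /weight big_mkord; apply: eq_bigr => i _; rewrite inE.
Qed.

End Ring.
End AbIndex.

Import numFieldNormedType.Exports.
Local Open Scope classical_set_scope.

(** * Cutting relatively open polyhedra by hyperplanes *)

Section Geometry.
Context (R : realType) (n : nat) (H : arrangement R n).
Local Notation I := 'I_(nb_hyp H).
Local Notation V := 'rV[R]_n.
Implicit Types (i g : I) (u v w : V) (Z : {set I}).

Definition dot i u : R := (u *m (normal i)^T) 0 0.
Definition val_at i v : R := dot i v - offset i.

Lemma dotD i u v : dot i (u + v) = dot i u + dot i v.
Proof. by rewrite /dot mulmxDl mxE. Qed.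

Lemma dotZ i t u : dot i (t *: u) = t * dot i u.
Proof. by rewrite /dot -scalemxAl mxE. Qed.

Lemma dotN i u : dot i (- u) = - dot i u.
Proof. by rewrite /dot mulNmx mxE. Qed.

Lemma dotB i u v : dot i (u - v) = dot i u - dot i v.
Proof. by rewrite dotD dotN. Qed.

Lemma sideE i v : side i v = Num.sg (val_at i v).
Proof. by []. Qed.

Lemma val_at_move i v t u : val_at i (v + t *: u) = val_at i v + t * dot i u.
Proof. by rewrite /val_at dotD dotZ addrAC. Qed.

Lemma val_atB i v w : dot i (w - v) = val_at i w - val_at i v.
Proof. by rewrite /val_at dotB; lra. Qed.

Lemma hypE i v : hyp i v <-> side i v = 0.
Proof.
rewrite sideE; split; rewrite /hyp /hyperplane /val_at /dot /=.
  by move=> ->; rewrite subrr sgr0.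
by move=> /eqP; rewrite sgr_eq0 subr_eq0 => /eqP.
Qed.

Definition span_of Z : 'M[R]_n := (\sum_(i in Z) <<normal i>>)%MS.
Definition rkZ Z : nat := \rank (span_of Z).
Definition orth Z u : Prop := forall i, i \in Z -> dot i u = 0.

Lemma dot_eq0 i u : dot i u = 0 <-> normal i *m u^T = 0.
Proof.
have -> : normal i *m u^T = (u *m (normal i)^T)^T by rewrite trmx_mul trmxK.
rewrite /dot; split=> [e|/matrixP/(_ 0 0)]; last by rewrite !mxE.
by apply/matrixP => j k; rewrite !ord1 !mxE; move: e; rewrite mxE.
Qed.

Lemma orthP Z u : orth Z u <-> span_of Z *m u^T = 0.
Proof.
split=> [oZ|/sub_kermxP /sumsmx_subP sZ i iZ].
  apply/sub_kermxP/sumsmx_subP => i iZ; rewrite genmxE.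
  by apply/sub_kermxP/dot_eq0/oZ.
by apply/dot_eq0/sub_kermxP; have := sZ i iZ; rewrite genmxE.
Qed.

Lemma normal_sub_span Z i : i \in Z -> (normal i <= span_of Z)%MS.
Proof. by move=> iZ; apply: (sumsmx_sup i); rewrite // genmxE. Qed.

Lemma span_subset Z1 Z2 : Z1 \subset Z2 -> (span_of Z1 <= span_of Z2)%MS.
Proof.
move=> /subsetP s; apply/sumsmx_subP => i /s iZ; rewrite genmxE.
exact: normal_sub_span.
Qed.

Lemma span_setU1 g Z : (span_of (g |: Z) :=: normal g + span_of Z)%MS.
Proof.
apply/eqmxP/andP; split.
  apply/sumsmx_subP => i; rewrite !inE genmxE => /orP[/eqP->|iZ].
    exact: addsmxSl.
  exact: submx_trans (normal_sub_span iZ) (addsmxSr _ _).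
by rewrite addsmx_sub normal_sub_span ?setU11 // span_subset ?subsetU1.
Qed.

Lemma dot_span g Z u : (normal g <= span_of Z)%MS -> orth Z u -> dot g u = 0.
Proof.
move=> gZ /orthP /sub_kermxP oZ.
by apply/dot_eq0/sub_kermxP/(submx_trans gZ).
Qed.

Lemma dot_not_span g Z : ~~ (normal g <= span_of Z)%MS ->
  exists u, orth Z u /\ dot g u = 1.
Proof.
rewrite submxE => /matrix0Pn[j [k njk]].
(* A column of the cokernel matrix is orthogonal to all normals of Z; the chosen one is not
   orthogonal to the normal of g. *)
pose u : V := (col k (cokermx (span_of Z)))^T.
have du i : dot i u = (normal i *m cokermx (span_of Z)) 0 k.
  rewrite /dot /u -trmx_mul !mxE; apply: eq_bigr => l _; by rewrite !mxE.
have oZ : orth Z u.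
  by apply/orthP; rewrite /u trmxK colE mulmxA mulmx_coker mul0mx.
exists ((dot g u)^-1 *: u); split=> [i iZ|]; first by rewrite dotZ (oZ i iZ)
  mulr0.
by rewrite dotZ mulVf // du; move: njk; rewrite ord1.
Qed.

Lemma rk_in g Z : (normal g <= span_of Z)%MS -> rkZ (g |: Z) = rkZ Z.
Proof.
move=> gZ; rewrite /rkZ span_setU1; apply/eqmx_rank/andP; split.
  by rewrite addsmx_sub gZ submx_refl.
exact: addsmxSr.
Qed.

Lemma rk_notin g Z : ~~ (normal g <= span_of Z)%MS -> rkZ (g |: Z) = (rkZ Z).+1.
Proof.
move=> gZ; rewrite /rkZ span_setU1.
have := mxrank_sum_cap (normal g) (span_of Z).
rewrite rank_rV normal_neq0 add1n => <-.
suff -> : \rank (normal g :&: span_of Z)%MS = 0%N by rewrite addn0.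
apply/eqP; rewrite -leqn0 leqNgt; apply: contra gZ => r0.
apply: submx_trans (capmxSr (normal g) _).
rewrite -(geq_leqif (mxrank_leqif_sup (capmxSl _ _))).
by rewrite rank_rV normal_neq0.
Qed.

Lemma rk_le Z : (rkZ Z <= n)%N.
Proof. exact: rank_leq_col. Qed.

Definition flat Z : set V := [set v | forall i, i \in Z -> side i v = 0].

Lemma flat_orth Z v w : flat Z v -> flat Z w -> orth Z (w - v).
Proof.
move=> vZ wZ i iZ; rewrite val_atB.
move: (vZ _ iZ) (wZ _ iZ); rewrite !sideE => /eqP + /eqP.
by rewrite !sgr_eq0 => /eqP -> /eqP ->; rewrite subrr.
Qed.

Lemma flat_span g Z v w : (normal g <= span_of Z)%MS ->
  flat Z v -> flat Z w -> side g v = side g w.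
Proof.
move=> gZ vZ wZ; rewrite !sideE; congr Num.sg; apply/esym/eqP.
by rewrite -subr_eq0 -val_atB (dot_span gZ (flat_orth vZ wZ)).
Qed.

(** At equal rank the two families of normals have the same span, so each hyperplane of Z2 has a
    constant side on the flat of Z1, which is 0 at v. *)
Lemma flat_rk_eq Z1 Z2 v : Z1 \subset Z2 -> (rkZ Z2 <= rkZ Z1)%N -> flat Z2 v ->
  flat Z1 `<=` flat Z2.
Proof.
move=> s12 r21 v2 w w1 i i2.
have v1 : flat Z1 v by move=> j /(subsetP s12) /v2.
rewrite -(v2 i i2); apply: (@flat_span i Z1) => //.
apply: submx_trans (normal_sub_span i2) _.
by rewrite -(geq_leqif (mxrank_leqif_sup (span_subset s12))).
Qed.

(* A list of pairs (i, e) prescribes the sides e of the hyperplanes i. *)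
Local Notation constraints := (seq (I * R)).
Implicit Types (tau sigma : constraints).

Definition sat tau v := all (fun p => side p.1 v == p.2) tau.
Definition cell tau : set V := [set v | sat tau v].
Definition zeros tau : {set I} := [set i | (i, 0) \in tau]%SET.
Definition dom tau : {set I} := [set i | i \in map fst tau]%SET.

Lemma satP tau v : reflect (forall p, p \in tau -> side p.1 v = p.2) (sat tau
  v).
Proof. by apply: (iffP allP) => h p /h /eqP. Qed.

Lemma zeros_cons g e tau :
  zeros ((g, e) :: tau) = if e == 0 then g |: zeros tau else zeros tau.
Proof.
apply/setP => i; rewrite inE in_cons xpair_eqE [0 == e]eq_sym.
by case: (e == 0); rewrite !inE ?andbT ?andbF.
Qed.

Lemma dom_cons g e tau : dom ((g, e) :: tau) = g |: dom tau.
Proof. by apply/setP => i; rewrite !inE. Qed.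

Lemma cell_flat tau v : sat tau v -> flat (zeros tau) v.
Proof. by move=> /satP s i; rewrite inE => /s. Qed.

Lemma sg_near (x d : R) : x != 0 ->
  exists2 e, 0 < e & forall t, `|t| <= e -> Num.sg (x + t * d) = Num.sg x.
Proof.
move=> x0; have d1 : 0 < `|d| + 1 by rewrite ltr_wpDl.
exists (`|x| / 2 / (`|d| + 1)); first by rewrite !divr_gt0 ?normr_gt0.
move=> t; rewrite ler_pdivlMr // => tx.
have {tx} : `|t * d| < `|x|.
  rewrite normrM; apply: (@le_lt_trans _ _ (`|t| * (`|d| + 1))).
    by rewrite ler_wpM2l // lerDl.
  by apply: (le_lt_trans tx); rewrite ltr_pdivrMr // ltr_pMr ?normr_gt0 //
    ltr1n.
set y := t * d; rewrite ltr_norml; case: (ltrgt0P x) x0 => // x0 _ /andP[h1 h2].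
  by rewrite !gtr0_sg //; lra.
by rewrite !ltr0_sg //; lra.
Qed.

(** A cell is open in the flat of its zero constraints. One radius serves finitely many directions,
    so that a whole basis can be scaled in [dim_cell]. *)
Lemma sat_near tau v (us : seq V) : sat tau v ->
  (forall u, u \in us -> orth (zeros tau) u) ->
  exists2 d, 0 < d & forall u t, u \in us -> `|t| <= d -> sat tau (v + t *: u).
Proof.
move=> st; elim: us => [|u us IHus] oZ; first by exists 1.
have [d d0 hd] : exists2 d, 0 < d & forall t, `|t| <= d -> sat tau (v + t *: u).
  have : orth (zeros tau) u by apply: oZ; rewrite mem_head.
  elim: tau st {IHus oZ} => [|[g e] tau IH] st oZ; first by exists 1.
  move: st => /= /andP[/eqP sg st].
  have [|d d0 hd] := IH st.
    by move=> i; rewrite inE => it; apply: oZ; rewrite inE in_cons it orbT.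
  have [e' e0 he] : exists2 e', 0 < e' &
      forall t, `|t| <= e' -> side g (v + t *: u) = e.
    have [z|nz] := eqVneq (val_at g v) 0.
      exists 1 => // t _; rewrite sideE val_at_move -sg sideE z sgr0.
      rewrite oZ ?mulr0 ?addr0 ?sgr0 // inE in_cons xpair_eqE eqxx /=.
      by rewrite -sg sideE z sgr0 eqxx.
    have [e' e0 he] := sg_near (dot g u) nz.
    by exists e' => // t te; rewrite sideE val_at_move he // -sg.
  exists (Num.min d e'); first by rewrite lt_min d0.
  by move=> t; rewrite le_min => /andP[td te]; rewrite he ?eqxx //= hd.
have [d' d0' hd'] := IHus (fun u' u's => oZ u' (mem_behead (s := u :: us) u's)).
exists (Num.min d d'); first by rewrite lt_min d0.
move=> u' t; rewrite in_cons le_min => /orP[/eqP->|u's] /andP[td td'].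
  exact: hd.
exact: hd'.
Qed.

Lemma sg_convex (x y t : R) : Num.sg x = Num.sg y -> 0 <= t <= 1 ->
  Num.sg (x + t * (y - x)) = Num.sg x.
Proof.
move=> xy /andP[t0 t1].
have -> : x + t * (y - x) = (1 - t) * x + t * y by lra.
have s0 : 0 <= 1 - t by rewrite subr_ge0.
case: (ltrgt0P x) xy => [x0|x0|->].
- move=> /esym/eqP; rewrite (gtr0_sg x0) sgr_cp0 => y0.
  apply: gtr0_sg; have [->|t'] := eqVneq t 0; first by rewrite mul0r addr0
    subr0 mul1r.
  by rewrite ltr_wpDl ?mulr_ge0 ?(ltW x0) // mulr_gt0 // lt_neqAle eq_sym t'.
- move=> /esym/eqP; rewrite (ltr0_sg x0) sgr_cp0 => y0.
  apply: ltr0_sg; have [->|t'] := eqVneq t 0; first by rewrite mul0r addr0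
    subr0 mul1r.
  by rewrite ltr_wnDl ?mulr_ge0_le0 ?(ltW x0) // pmulr_rlt0 // lt_neqAle
    eq_sym t'.
by rewrite sgr0 => /esym/eqP; rewrite sgr_eq0 => /eqP ->; rewrite !mulr0 addr0
  sgr0.
Qed.

Lemma sg_zero (x y : R) : x != 0 -> y != 0 -> Num.sg x != Num.sg y ->
  exists2 t, 0 <= t <= 1 & x + t * (y - x) = 0.
Proof.
move=> x0 y0 xy; have yx : y - x != 0 by rewrite subr_eq0; apply: contra_neq
  xy => ->.
exists (- x / (y - x)); last by rewrite divfK // subrr.
case: (ltrgt0P x) x0 xy yx => // x0 _ xy yx.
  have {}y0 : y < 0.
    rewrite lt_neqAle y0 leNgt; apply: contra xy => y1.
    by rewrite !gtr0_sg.
  by rewrite -mulrNN -invrN opprK opprB divr_ge0 ?ler_pdivrMr ?subr_ge0; lra.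
have {}y0 : 0 < y.
  rewrite lt_neqAle eq_sym y0 leNgt; apply: contra xy => y1.
  by rewrite !ltr0_sg.
by rewrite divr_ge0 ?ler_pdivrMr ?subr_ge0; lra.
Qed.

Lemma sat_convex tau v w t : sat tau v -> sat tau w -> 0 <= t <= 1 ->
  sat tau (v + t *: (w - v)).
Proof.
move=> /satP sv /satP sw t01; apply/satP => p pt.
rewrite sideE val_at_move val_atB sg_convex //; first exact: sv.
by rewrite -!sideE sv ?sw.
Qed.

Definition nonempty tau : bool := `[< exists v, sat tau v >].
Definition signs : seq R := [:: 0; 1; -1].

Lemma side_signs i v : side i v \in signs.
Proof.
by rewrite sideE !inE; case: sgrP => _; rewrite eqxx ?orbT.
Qed.

Lemma nonempty_cons p tau : nonempty (p :: tau) -> nonempty tau.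
Proof. by move=> /asboolP[v /= /andP[_ sv]]; apply/asboolP; exists v. Qed.

(** A hyperplane either leaves the cell on one side or properly cuts it into three nonempty pieces.
    By convexity, a cell with two different sides meets the hyperplane. *)
Lemma cut_cases g tau : nonempty tau ->
  (exists e0, [/\ forall v, sat tau v -> side g v = e0, e0 \in signs
     & e0 = 0 -> (normal g <= span_of (zeros tau))%MS]) \/
  (~~ (normal g <= span_of (zeros tau))%MS /\
   forall e, e \in signs -> nonempty ((g, e) :: tau)).
Proof.
move=> /asboolP[v sv].
have [gs|gs] := boolP (normal g <= span_of (zeros tau))%MS.
  left; exists (side g v); split=> //; last exact: side_signs.
  by move=> w sw; apply: (flat_span gs); apply: cell_flat.
have [[w [sw w0]]|nz] := pselect (exists w, sat tau w /\ side g w = 0).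
  right; split=> // e eS; have [u [oZ gu]] := dot_not_span gs.
  have [d d0 hd] : exists2 d, 0 < d &
      forall u' t, u' \in [:: u] -> `|t| <= d -> sat tau (w + t *: u').
    by apply: sat_near => // u'; rewrite inE => /eqP ->.
  (* From the point w on the hyperplane, a short step along u, transversal to g but inside the flat
     of the cell, reaches side e. *)
  apply/asboolP; exists (w + (e * d) *: u) => /=.
  have e1 : `|e| <= 1.
    by move: eS; rewrite !inE => /or3P[]/eqP ->; rewrite ?normr0 ?normrN1
      ?normr1.
  rewrite hd ?mem_head ?andbT //; last by rewrite normrM (gtr0_norm d0)
    ler_piMl // ltW.
  rewrite sideE val_at_move gu mulr1.
  have /eqP := w0; rewrite sideE sgr_eq0 => /eqP ->; rewrite add0r sgrM.
  rewrite (gtr0_sg d0) mulr1.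
  by move: eS; rewrite !inE => /or3P[]/eqP ->; rewrite ?sgr0 ?sgrN ?sgr1.
left; exists (side g v); split; last 2 first.
- exact: side_signs.
- by move=> v0; case: nz; exists v.
move=> w sw; apply/eqP/negPn/negP => vw; apply: (nz).
have sgn0 x : sat tau x -> val_at g x != 0.
  move=> sx; apply/eqP => x0; apply: (nz); exists x.
  by rewrite sideE x0 sgr0.
rewrite eq_sym in vw; have [t t01 tz] := sg_zero (sgn0 v sv) (sgn0 w sw) vw.
exists (v + t *: (w - v)); split; first exact: sat_convex.
by rewrite sideE val_at_move val_atB tz sgr0.
Qed.

(** The exponent is the codimension of the cell, which changes (-1)^dim by the global sign (-1)^n
    only. *)
Definition euler_weight tau : int :=
  if nonempty tau then (-1) ^+ rkZ (zeros tau) else 0.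

Lemma nonempty_side g e0 tau e : nonempty tau ->
  (forall v, sat tau v -> side g v = e0) -> nonempty ((g, e) :: tau) = (e ==
    e0).
Proof.
move=> /asboolP[v sv] h; apply/asboolP/eqP => [[w /= /andP[/eqP <- /h]] //|->].
by exists v; rewrite /= sv h ?eqxx.
Qed.

Lemma signs_eqE : ((0 == 1 :> R) = false) * ((1 == 0 :> R) = false) *
  ((0 == -1 :> R) = false) * ((-1 == 0 :> R) = false) *
  ((1 == -1 :> R) = false) * ((-1 == 1 :> R) = false) *
  ((0 == 0 :> R) = true) * ((1 == 1 :> R) = true) * ((-1 == -1 :> R) = true).
Proof. by do !split; apply/eqP => //; lra. Qed.

(** An uncut cell reappears as the only nonempty piece. A proper cut gives two pieces of the same
    codimension and one of codimension one more. *)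
Lemma cut_euler_weight g tau :
  euler_weight ((g, 0) :: tau) +
  (euler_weight ((g, 1) :: tau) + euler_weight ((g, -1) :: tau)) =
  euler_weight tau.
Proof.
rewrite /euler_weight; case: (boolP (nonempty tau)) => net; last first.
  by rewrite !(negbTE (contra (@nonempty_cons _ _) net)).
rewrite !zeros_cons !signs_eqE.
case: (cut_cases g net) => [[e0 [h eS e0s]]|[gs ne]].
  rewrite !(nonempty_side _ net h); move: eS e0s; rewrite !inE.
  case/or3P=> /eqP-> e0s; rewrite !signs_eqE ?addr0 ?add0r //.
  by rewrite rk_in ?e0s.
rewrite !ne ?inE ?eqxx ?orbT //; rewrite rk_notin // exprS; lia.
Qed.

(* u is in the recession cone of the cell, if the cell is nonempty. *)
Definition rec tau u : Prop := forall p, p \in tau ->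
  0 <= p.2 * dot p.1 u /\ (p.2 = 0 -> dot p.1 u = 0).

(* The recession cone is a linear space. *)
Definition lineal tau : bool := `[< forall u, rec tau u -> orth (dom tau) u >].

(* The exponent is dim - l modulo 2, where l is the dimension of the recession
   cone. *)
Definition recession_weight tau : int :=
  if nonempty tau && lineal tau
  then (-1) ^+ (rkZ (dom tau) + rkZ (zeros tau)) else 0.

Lemma rec_cons g e tau u : rec ((g, e) :: tau) u <->
  [/\ 0 <= e * dot g u, e = 0 -> dot g u = 0 & rec tau u].
Proof.
split=> [r|[h1 h2 r] p]; last by rewrite in_cons => /orP[/eqP ->|/r].
have [h1 h2] := r (g, e) (mem_head _ _).
by split=> // p pt; apply: r; rewrite in_cons pt orbT.
Qed.

Lemma orth_setU1 g Z u : orth (g |: Z) u <-> dot g u = 0 /\ orth Z u.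
Proof.
split=> [o|[g0 o] i]; last by rewrite !inE => /orP[/eqP ->|/o].
by split=> [|i iZ]; apply: o; rewrite !inE ?eqxx ?iZ ?orbT.
Qed.

Lemma orth_dom_rec tau u : orth (dom tau) u -> rec tau u.
Proof.
move=> o p pt; have -> : dot p.1 u = 0 by apply: o; rewrite inE map_f.
by rewrite mulr0.
Qed.

Lemma rec_zeros tau u : rec tau u -> orth (zeros tau) u.
Proof. by move=> r i; rewrite inE => /r /= [_ ->]. Qed.

Lemma orthN Z u : orth Z u -> orth Z (- u).
Proof. by move=> o i /o; rewrite dotN => ->; rewrite oppr0. Qed.

Lemma sat_rec tau v u t : sat tau v -> rec tau u -> 0 <= t ->
  sat tau (v + t *: u).
Proof.
move=> /satP sv r t0; apply/satP => p pt; have [h1 h2] := r p pt.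
rewrite sideE val_at_move; have := sv p pt; rewrite sideE => e.
case: (ltrgt0P (val_at p.1 v)) e => [x0|x0|x0].
- rewrite gtr0_sg // => e; move: h1; rewrite -e mul1r => h1.
  by apply: gtr0_sg; rewrite ltr_wpDr // mulr_ge0.
- rewrite ltr0_sg // => e; move: h1; rewrite -e mulN1r oppr_ge0 => h1.
  by apply: ltr0_sg; rewrite ltr_wnDr // mulr_ge0_le0.
by rewrite x0 sgr0 => e; rewrite h2 // mulr0 addr0 sgr0.
Qed.

(** A ray in the cell directed against the side e0 would meet the hyperplane g inside the cell,
    where the side is 0. *)
Lemma rec_one_sided g e0 tau u v : sat tau v ->
  (forall v, sat tau v -> side g v = e0) ->
  (e0 = 0 -> (normal g <= span_of (zeros tau))%MS) ->
  rec tau u -> rec ((g, e0) :: tau) u.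
Proof.
move=> sv h e0s r; apply/rec_cons; split=> //; last first.
  by move=> /e0s gs; apply: dot_span gs (rec_zeros r).
rewrite leNgt; apply/negP => neg.
have e0n : e0 != 0 by apply: contraTneq neg => ->; rewrite mul0r ltxx.
have d0 : dot g u != 0 by apply: contraTneq neg => ->; rewrite mulr0 ltxx.
have t0 : 0 <= - val_at g v / dot g u.
  have := h v sv; rewrite sideE => se; rewrite -se in neg e0n.
  rewrite mulNr oppr_ge0.
  case: (ltrgt0P (val_at g v)) neg => [x0|x0|->]; last by rewrite mul0r.
    rewrite gtr0_sg // mul1r => dn.
    by rewrite pmulr_rle0 // invr_le0 ltW.
  rewrite ltr0_sg // mulN1r oppr_lt0 => dp.
  by rewrite nmulr_rle0 // invr_ge0 ltW.
have := h _ (sat_rec sv r t0).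
by rewrite sideE val_at_move divfK // subrr sgr0 => e; rewrite -e eqxx in e0n.
Qed.

Lemma recession_one_sided g e0 tau : nonempty tau ->
  (forall v, sat tau v -> side g v = e0) ->
  (e0 = 0 -> (normal g <= span_of (zeros tau))%MS) ->
  recession_weight ((g, e0) :: tau) = recession_weight tau.
Proof.
move=> net h e0s; rewrite /recession_weight (nonempty_side _ net h) eqxx net /=.
have [v sv] := asboolP _ net.
have rr u : rec tau u -> rec ((g, e0) :: tau) u.
  exact: (rec_one_sided sv h e0s).
(* A direction orthogonal to [dom tau] lies in the recession cone together with its negative; both
   respect the implied constraint, so g vanishes on it. *)
have gdom : lineal tau -> (normal g <= span_of (dom tau))%MS.
  move=> _; apply/negPn/negP => /dot_not_span[u [ou gu]].
  have /rr /rec_cons[h1 h2 _] := orth_dom_rec ou.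
  have /rr /rec_cons[h3 _ _] := orth_dom_rec (orthN ou).
  have e00 : e0 = 0.
    by apply/eqP; rewrite eq_le; move: h1 h3; rewrite dotN gu mulr1 mulrN1
      oppr_ge0 => -> ->.
  by have := h2 e00; rewrite gu => /eqP; rewrite oner_eq0.
have -> : lineal ((g, e0) :: tau) = lineal tau.
  apply/asboolP/asboolP => P u.
    by move=> /rr /P; rewrite dom_cons => /orth_setU1[].
  move=> /rec_cons[_ _ /P ou]; rewrite dom_cons; apply/orth_setU1; split=> //.
  by apply: dot_span ou; apply: gdom; apply/asboolP.
case: ifP => // /gdom gd; rewrite dom_cons zeros_cons rk_in //.
by case: eqP => // /e0s gs; rewrite rk_in.
Qed.

Lemma lineal_sub g e tau : lineal ((g, e) :: tau) -> lineal ((g, 0) :: tau).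
Proof.
move=> /asboolP P; apply/asboolP => u /rec_cons[_ h2 r].
have -> : dom ((g, 0) :: tau) = dom ((g, e) :: tau) by rewrite !dom_cons.
by apply: P; apply/rec_cons; split=> //; rewrite h2 // mulr0.
Qed.

Lemma lineal_same g e tau : lineal tau ->
  (normal g <= span_of (dom tau))%MS -> lineal ((g, e) :: tau).
Proof.
move=> /asboolP P gs; apply/asboolP => u /rec_cons[_ _ /P ou].
by rewrite dom_cons; apply/orth_setU1; split=> //; apply: dot_span gs ou.
Qed.

Lemma lineal_zero g tau : lineal tau -> lineal ((g, 0) :: tau).
Proof.
move=> /asboolP P; apply/asboolP => u /rec_cons[_ h2 /P ou].
by rewrite dom_cons; apply/orth_setU1; split=> //; apply: h2.
Qed.

(** Some line in the recession cone crosses the hyperplane direction of g; the new constraint keeps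
    one ray of it and drops the opposite one. *)
Lemma not_lineal_half g e tau : e != 0 ->
  ~~ (normal g <= span_of (dom tau))%MS -> ~~ lineal ((g, e) :: tau).
Proof.
move=> e0 /dot_not_span[u [ou gu]]; apply/asboolP => P.
have /P : rec ((g, e) :: tau) (e *: u).
  apply/rec_cons; split=> [|/eqP|]; rewrite ?(negbTE e0) //.
    by rewrite dotZ gu mulr1 -expr2 sqr_ge0.
  by apply: orth_dom_rec => i id; rewrite dotZ ou // mulr0.
rewrite dom_cons => /orth_setU1[+ _]; rewrite dotZ gu mulr1 => /eqP.
by rewrite (negbTE e0).
Qed.

(* If the slice of a non-linear recession cone by a hyperplane is linear, then
   the cone has points on only one side of the hyperplane. *)
Lemma lineal_split g tau : ~~ lineal tau -> lineal ((g, 0) :: tau) ->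
  lineal ((g, 1) :: tau) = ~~ lineal ((g, -1) :: tau).
Proof.
move=> /asboolP /existsNP[u /not_implyP[ru nou]] /asboolP P0.
have gu0 : dot g u != 0.
  apply/eqP => gu; apply: nou.
  have : rec ((g, 0) :: tau) u by apply/rec_cons; rewrite gu mulr0.
  by move/P0; rewrite dom_cons => /orth_setU1[].
(* Here e is the side of g towards which u points: that half keeps u, and the opposite half is shown
   to be linear. *)
have key e : (e = 1 \/ e = -1) -> 0 < e * dot g u ->
    ~~ lineal ((g, e) :: tau) /\ lineal ((g, - e) :: tau).
  move=> e1 egu; have e0 : e != 0 by apply: contraTneq egu => ->; rewrite
    mul0r ltxx.
  split.
    apply/asboolP => /(_ u); rewrite dom_cons => h.
    have /h /orth_setU1[_ /nou //] : rec ((g, e) :: tau) u.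
    by apply/rec_cons; split=> //; [exact: ltW | move=> /eqP; rewrite (negbTE
      e0)].
  apply/asboolP => w /rec_cons[h1 _ rw].
  have [gw|gw] := eqVneq (dot g w) 0.
    have : rec ((g, 0) :: tau) w by apply/rec_cons; rewrite gw mulr0.
    by move/P0; rewrite !dom_cons.
  have egw : e * dot g w < 0.
    by rewrite lt_neqAle mulf_neq0 //= -oppr_ge0 -mulNr.
  (* The positive multiple for which w + t u lies in the slice by g. *)
  pose t := - dot g w / dot g u.
  have t0 : 0 < t.
    by rewrite /t mulNr oppr_gt0; move: egw egu; case: e1 => ->;
      rewrite ?mul1r ?mulN1r ?oppr_lt0 ?oppr_gt0 => a1 a2;
      [rewrite nmulr_rlt0 ?invr_gt0 | rewrite pmulr_rlt0 ?invr_lt0].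
  have : rec ((g, 0) :: tau) (w + t *: u).
    apply/rec_cons; rewrite mul0r lexx dotD dotZ /t divfK // subrr; split=> //.
    move=> p pt; have [w1 w2] := rw p pt; have [u1 u2] := ru p pt.
    rewrite dotD dotZ mulrDr mulrCA; split.
      by rewrite addr_ge0 // mulr_ge0 // ltW.
    by move=> p0; rewrite w2 // u2 // mulr0 addr0.
  move/P0; rewrite dom_cons => /orth_setU1[_ oo].
  case: nou => i; rewrite inE => /mapP[[j s] pt /= ->].
  have [w1 w2] := rw _ pt; have [u1 u2] := ru _ pt; rewrite /= in w1 w2 u1 u2.
  have [/u2 //|s0] := eqVneq s 0.
  have := oo j; rewrite inE (map_f fst pt) dotD dotZ => /(_ isT) hz.
  (* The numbers [s * dot j w] and [t * (s * dot j u)] are nonnegative with sum 0, so u vanishes on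
     every constraint, against its choice. *)
  have : s * dot j u = 0.
    have ez : s * dot j w + t * (s * dot j u) = 0.
      by rewrite mulrCA -mulrDr hz mulr0.
    by apply/eqP; rewrite eq_le u1 andbT -(pmulr_rle0 _ t0); lra.
  by move/eqP; rewrite mulf_eq0 (negbTE s0) => /eqP.
case: (ltrgt0P (dot g u)) gu0 => // gu _.
  have [] := key 1 (or_introl erefl); first by rewrite mul1r.
  by move=> /negbTE -> ->.
have [] := key (-1) (or_intror erefl); first by rewrite mulN1r oppr_gt0.
by rewrite opprK => /negbTE -> ->.
Qed.

(** For a proper cut of a cell with linear recession cone: if g is constant along the cone, all
    three pieces count, with one sign reversed; otherwise only the slice does, both ranks having
    grown by one. If the cone is not linear, either no piece counts, or the slice and exactly one
    half do, with opposite signs. *)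
Lemma cut_recession_weight g tau :
  recession_weight ((g, 0) :: tau) +
  (recession_weight ((g, 1) :: tau) + recession_weight ((g, -1) :: tau)) =
  recession_weight tau.
Proof.
case: (boolP (nonempty tau)) => net; last first.
  rewrite /recession_weight (negbTE net).
  by rewrite !(negbTE (contra (@nonempty_cons _ _) net)).
case: (cut_cases g net) => [[e0 [h eS e0s]]|[gs ne]].
  rewrite -(recession_one_sided net h e0s).
  rewrite /recession_weight !(nonempty_side _ net h); move: eS; rewrite !inE.
  by case/or3P=> /eqP->; rewrite !signs_eqE /= ?addr0 ?add0r.
rewrite /recession_weight net !ne ?inE ?eqxx ?orbT //=.
rewrite !dom_cons !zeros_cons !signs_eqE (rk_notin gs) addnS exprS mulN1r.
have [P|P] := boolP (lineal tau).
  have [gd|gd] := boolP (normal g <= span_of (dom tau))%MS.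
    by rewrite !lineal_same // rk_in //; lia.
  rewrite lineal_zero // !(negbTE (not_lineal_half _ gd)) ?signs_eqE //.
  by rewrite rk_notin // addSn exprS; lia.
have [P0|P0] := boolP (lineal ((g, 0) :: tau)).
  by rewrite (lineal_split P P0); case: (lineal _) => /=; lia.
by rewrite !(negbTE (contra (@lineal_sub _ _ _) P0)).
Qed.

End Geometry.

(** * Faces *)

Section Faces.
Context (R : realType) (n : nat) (H : arrangement R n).
Local Notation I := 'I_(nb_hyp H).
Local Notation V := 'rV[R]_n.
Local Notation constraints := (seq (I * R)).
Implicit Types (i g : I) (u v w : V) (Z : {set I}) (tau sigma : constraints).
Implicit Types (s : seq I) (X F G : set V).

(** Empty cells are kept, so that a cut always yields three pieces; [face_list] discards them. *)
Fixpoint cells s tau : seq constraints :=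
  if s is g :: s' then
    cells s' ((g, 0) :: tau) ++
    (cells s' ((g, 1) :: tau) ++ cells s' ((g, -1) :: tau))
  else [:: tau].

Lemma sum_cells (h : constraints -> int) s tau :
  (forall g tau,
     h ((g, 0) :: tau) + (h ((g, 1) :: tau) + h ((g, -1) :: tau)) = h tau) ->
  \sum_(sigma <- cells s tau) h sigma = h tau.
Proof.
move=> cut; elim: s tau => [|g s IHs] tau /=; first by rewrite big_seq1.
by rewrite !big_cat /= !IHs.
Qed.

Lemma count_cells s tau v :
  count (fun sigma => sat sigma v) (cells s tau) = sat tau v.
Proof.
elim: s tau => [|g s IHs] tau /=; first by rewrite addn0.
rewrite !count_cat !IHs /=; case: (sat tau v); rewrite ?andbF ?andbT //.
have := side_signs g v; rewrite !inE.
by case/or3P=> /eqP ->; rewrite !signs_eqE.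
Qed.

Lemma cells_sub s tau sigma : sigma \in cells s tau -> {subset tau <= sigma}.
Proof.
elim: s tau => [|g s IHs] tau /=; first by rewrite inE => /eqP ->.
by rewrite !mem_cat => /or3P[] /IHs sub p pt; apply: sub; rewrite in_cons pt
  orbT.
Qed.

Lemma cells_dom s tau sigma i : sigma \in cells s tau ->
  i \in s \/ i \in dom tau -> i \in dom sigma.
Proof.
elim: s tau => [|g s IHs] tau /=; first by rewrite inE => /eqP -> [].
rewrite !mem_cat in_cons => si is_.
by case/or3P: si => /IHs; apply; rewrite dom_cons !inE;
  case: is_ => [/orP[->|->]|]; rewrite ?inE ?orbT; auto; move=> ->; rewrite
    orbT; right.
Qed.

Definition face v : set V := [set w | forall i, side i w = side i v].

Lemma cell_face sigma v : (forall i, i \in dom sigma) -> sat sigma v ->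
  cell sigma = face v.
Proof.
move=> dm /satP sv; apply/seteqP; split=> w.
  move=> /satP sw i; have := dm i; rewrite inE => /mapP[p ps ->].
  by rewrite sw ?sv.
by move=> wv; apply/satP => p ps; rewrite wv sv.
Qed.

Definition face_list s tau : seq (set V) :=
  [seq cell sigma | sigma <- cells s tau & nonempty sigma].

Lemma nonemptyP tau : reflect (exists v, sat tau v) (nonempty tau).
Proof. exact: asboolP. Qed.

Lemma mem_face_list s tau X : (forall i, i \in s \/ i \in dom tau) ->
  (X \in face_list s tau) <-> (faces H X /\ X `<=` cell tau).
Proof.
move=> cover; split.
  case/mapP => sigma; rewrite mem_filter => /andP[/nonemptyP[v sv] sc] ->.
  split; first by exists v; apply: cell_face => // i; apply: cells_dom sc _.
  move=> w /satP sw; apply/satP => p pt; apply: sw.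
  exact: (cells_sub sc).
move=> [[v ->] fsub]; have sv : sat tau v by apply: fsub.
have : has (fun sigma => sat sigma v) (cells s tau) by rewrite has_count
  count_cells sv.
case/hasP => sigma sc sgv; apply/mapP; exists sigma.
  by rewrite mem_filter sc andbT; apply/nonemptyP; exists v.
by apply/esym/cell_face => // i; apply: cells_dom sc _.
Qed.

(** Equal nonempty cells share a point, while [count_cells] puts a point in at most one cell of the
    list. *)
Lemma uniq_face_list s tau : uniq (face_list s tau).
Proof.
apply: count_mem_uniq => X; case: (boolP (X \in _)) => [Xin|/count_memPn -> //].
apply/eqP; rewrite eqn_leq -[(0 < _)%N]has_count has_pred1 Xin andbT.
case/mapP: Xin => sigma0; rewrite mem_filter => /andP[/nonemptyP[v sv] _] ->.
rewrite count_map; apply: leq_trans (_ : (sat tau v <= 1)%N); last by case: sat.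
rewrite -(count_cells s tau v) count_filter; apply: sub_count => sigma /=.
by move=> /andP[/eqP e _]; have : cell sigma0 v by []; rewrite -e.
Qed.

Definition all_faces : seq (set V) := face_list (enum I) [::].

Lemma mem_all_faces X : (X \in all_faces) <-> faces H X.
Proof.
rewrite mem_face_list; last by move=> i; left; rewrite mem_enum.
by split=> [[]|//].
Qed.

Lemma sum_cells_faces (phi : set V -> int) s tau :
  (forall i, i \in s \/ i \in dom tau) ->
  \sum_(sigma <- cells s tau) (if nonempty sigma then phi (cell sigma) else 0) =
  \sum_(F <- all_faces | `[< F `<=` cell tau >]) phi F.
Proof.
move=> cover; rewrite -big_mkcond -big_filter.
rewrite -(big_map (@cell R n H) predT) -[RHS]big_filter; apply: perm_big.
apply: uniq_perm; first exact: uniq_face_list.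
  exact/filter_uniq/uniq_face_list.
move=> X; rewrite mem_filter; apply/idP/andP.
  by case/(mem_face_list _ cover) => fX Xt; split; [apply/asboolP |
    apply/mem_all_faces].
by case=> /asboolP Xt /mem_all_faces fX; apply/(mem_face_list _ cover).
Qed.

(** Differences of points of the cell are orthogonal to the normals of its zero constraints, which
    bounds the dimension from above. Conversely, a basis of that orthogonal space, scaled down, fits
    in the relatively open cell. *)
Lemma dim_cell sigma : nonempty sigma ->
  dim (cell sigma) = (n - rkZ (zeros sigma))%N.
Proof.
move=> /nonemptyP[v sv]; set K := kermx (span_of (zeros sigma))^T.
have rK : \rank K = (n - rkZ (zeros sigma))%N by rewrite mxrank_ker mxrank_tr.
apply/eqP; rewrite eqn_leq; apply/andP; split.
  apply/bigmax_leqP => k /asboolP[x0 [M [x0X MX free]]].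
  rewrite -rK; move: free; rewrite /row_free => /eqP <-; apply: mxrankS.
  apply/row_subP => j; apply/sub_kermxP; apply: trmx_inj.
  rewrite trmx_mul trmxK trmx0; apply/orthP.
  have := flat_orth (cell_flat x0X) (cell_flat (MX j)).
  by rewrite addrC addKr.
have kn : (n - rkZ (zeros sigma) < n.+1)%N by rewrite ltnS leq_subr.
rewrite -rK; rewrite -rK in kn.
apply: (@leq_bigmax_cond _ _ (fun k : 'I_n.+1 => nat_of_ord k) (Ordinal kn)).
apply/asboolP => /=.
have inK j : orth (zeros sigma) (row j (row_base K)).
  apply/orthP; apply: trmx_inj; rewrite trmx_mul trmxK trmx0; apply/sub_kermxP.
  by rewrite (submx_trans (row_sub _ _)) // eq_row_base.
have [|d d0 hd] := @sat_near _ _ _ _ _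
    [seq row j (row_base K) | j <- enum 'I_(\rank K)] sv.
  by move=> u /mapP[j _ ->].
exists v, (d *: row_base K); split => //.
  move=> j; rewrite linearZ /=; apply: hd; last by rewrite gtr0_norm.
  by apply: map_f; rewrite mem_enum.
by rewrite /row_free mxrank_scale_nz ?lt0r_neq0 // -[_ == _]/(row_free _)
  row_base_free.
Qed.

Lemma rho_cell sigma : nonempty sigma -> rho (cell sigma) = rkZ (zeros sigma).
Proof.
move=> ns; rewrite /rho dim_cell // subKn ?rk_le //.
case: eqP => // e; case/nonemptyP: ns => v sv.
by have : cell sigma v by []; rewrite e.
Qed.

Lemma sum_euler_faces s tau : (forall i, i \in s \/ i \in dom tau) ->
  nonempty tau ->
  \sum_(F <- all_faces | `[< F `<=` cell tau >]) (-1) ^+ rho F =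
  (-1) ^+ rho (cell tau) :> int.
Proof.
move=> cover nt; rewrite -(sum_cells_faces _ cover) rho_cell //.
rewrite -[RHS](_ : euler_weight tau = _); last by rewrite /euler_weight nt.
rewrite -(sum_cells s tau (@cut_euler_weight R n H)).
by apply: eq_bigr => sigma _; rewrite /euler_weight; case: ifP => // /rho_cell
  ->.
Qed.

End Faces.

(** * Boundedness and closure of faces *)

Section Topology.
Context (R : realType) (n : nat) (H : arrangement R n).
Local Notation I := 'I_(nb_hyp H).
Local Notation V := 'rV[R]_n.
Local Notation constraints := (seq (I * R)).
Implicit Types (i g : I) (u v w : V) (Z : {set I}) (tau sigma : constraints).
Implicit Types (s : seq I) (X F G : set V).
Local Notation closure := topology_structure.closure.

Lemma dot_continuous i : continuous (fun u => dot i u).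
Proof.
have -> : (fun u => dot i u) = fun u => \sum_j u 0 j * normal i 0 j.
  by apply/funext => u; rewrite /dot mxE; apply: eq_bigr => j _; rewrite mxE.
apply: (continuous_big add_continuous) => j _ u.
by apply: continuousM; [exact: coord_continuous | exact: cst_continuous].
Qed.

(* On the sides of a nonempty cell, a sum of nonnegative terms that vanishes
   exactly on the recession cone. *)
Definition cost sigma u : R :=
  \sum_(p <- sigma) (`|dot p.1 u| - p.2 * dot p.1 u).

Lemma cost_continuous sigma : continuous (cost sigma).
Proof.
apply: (continuous_big add_continuous) => p _ u.
apply: (@continuousB _ R^o V (fun u => `|dot p.1 u|)
  (fun u => p.2 * dot p.1 u)).
  apply: continuous_comp; first exact: dot_continuous.
  exact: norm_continuous.
by apply: continuousM; [exact: cst_continuous | exact: dot_continuous].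
Qed.

Lemma costZ sigma t u : 0 <= t -> cost sigma (t *: u) = t * cost sigma u.
Proof.
move=> t0; rewrite /cost mulr_sumr; apply: eq_bigr => p _.
by rewrite dotZ normrM (ger0_norm t0) mulrBr mulrCA.
Qed.

Lemma cost_term_ge0 i u v : 0 <= `|dot i u| - side i v * dot i u.
Proof.
rewrite subr_ge0; apply: le_trans (ler_norm _) _; rewrite normrM.
by rewrite ler_piMl // sideE normr_sg; case: eqP.
Qed.

Lemma cost_ge0 sigma u v : sat sigma v -> 0 <= cost sigma u.
Proof.
move=> /satP sv; rewrite /cost big_seq sumr_ge0 // => p ps.
by rewrite -(sv p ps) cost_term_ge0.
Qed.

Lemma cost_eq0_rec sigma u v : sat sigma v -> cost sigma u = 0 -> rec sigma u.
Proof.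
move=> /satP sv /eqP; rewrite /cost big_seq psumr_eq0; last first.
  by move=> p ps; rewrite -(sv p ps) cost_term_ge0.
move=> /allP h p ps; have /implyP := h p ps; move=> /(_ ps).
by rewrite subr_eq0 => /eqP e; rewrite -e normr_ge0; split=> // p0; move: e;
  rewrite p0 mul0r => /eqP; rewrite normr_eq0 => /eqP.
Qed.

(** A term is 0 or twice the amount by which the value moves towards 0; as w stays on the side of v,
    this amount is at most the absolute value at v. *)
Lemma cost_sub_le sigma v w : sat sigma v -> sat sigma w ->
  cost sigma (w - v) <= \sum_(p <- sigma) 2 * `|val_at p.1 v|.
Proof.
move=> /satP sv /satP sw; rewrite /cost big_seq [leRHS]big_seq.
apply: ler_sum => p ps; rewrite val_atB.
have := sv p ps; have := sw p ps; rewrite !sideE => <-.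
move: (val_at p.1 v) (val_at p.1 w) => x y.
have [y0|y0|->] := ltrgt0P y; last first.
- by rewrite sgr0 => /eqP; rewrite sgr_eq0 => /eqP ->; rewrite !(subrr,
  normr0, mulr0).
- rewrite (ltr0_sg y0) => /eqP; rewrite sgr_cp0 => x0.
  by rewrite (ltr0_norm x0); case: (ler0P (y - x)) => _; lra.
rewrite (gtr0_sg y0) => /eqP; rewrite sgr_cp0 => x0.
by rewrite (gtr0_norm x0); case: (ler0P (y - x)) => _; lra.
Qed.

(** A nonzero recession direction gives an unbounded ray. Otherwise [cost] has a positive minimum on
    the unit sphere, and its homogeneity together with [cost_sub_le] bounds the distance from v. *)
Lemma bounded_cellP sigma : nonempty sigma ->
  bounded_set (cell sigma) <-> (forall u, rec sigma u -> u = 0).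
Proof.
move=> /nonemptyP[v sv]; split.
  move=> /ex_strict_bound_gt0[M M0 bM] u ru; apply/eqP/negPn/negP => u0.
  have Mv : 0 <= M + `|v| by rewrite addr_ge0 // ltW.
  have nt : `|((M + `|v|) / `|u|) *: u| = M + `|v|.
    by rewrite normrZ ger0_norm ?divr_ge0 // divfK // normr_eq0.
  have /bM /= : cell sigma (v + ((M + `|v|) / `|u|) *: u).
    by apply: sat_rec => //; rewrite divr_ge0.
  have := ler_normB (v + ((M + `|v|) / `|u|) *: u) v.
  by rewrite addrC addKr nt => h1 h2; lra.
move=> rec0; pose K : set V := [set u | `|u| = 1].
pose B := \sum_(p <- sigma) 2 * `|val_at p.1 v|.
have B0 : 0 <= B by apply: sumr_ge0 => p _; rewrite mulr_ge0.
(* The sphere is empty when n = 0; then the cell has no point besides v. *)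
have [K0|K0] := pselect (K !=set0); last first.
  exists `|v|; split=> [|M vM w sw /=]; first exact: num_real.
  have [->|wv] := eqVneq w v; first exact: ltW.
  case: K0; exists (`|w - v|^-1 *: (w - v)); rewrite /K /= normrZ normfV
    normr_id.
  by rewrite mulVf // normr_eq0 subr_eq0.
have cK : compact K.
  apply: bounded_closed_compact.
    by exists 1; split=> [|M M1 u /= ->]; [exact: num_real | exact: ltW].
  apply: (preimage_closed (f := fun u : V => `|u|) (D := [set x | x = 1])).
    by move=> u _; exact: norm_continuous.
  exact: closed_eq.
have [c cin cmin] := compact_EVT_min K0 cK
  (continuous_subspaceT (@cost_continuous sigma)).
have c1 : `|c| = 1 by move: cin; rewrite in_setE.
have d0 : 0 < cost sigma c.
  rewrite lt_neqAle (cost_ge0 _ sv) andbT eq_sym; apply/eqP => /(cost_eq0_rec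
    sv)/rec0 c0.
  by move: c1; rewrite c0 normr0 => /eqP; rewrite eq_sym oner_eq0.
have key w : sat sigma w -> `|w - v| <= B / cost sigma c.
  move=> sw; have [->|wv] := eqVneq w v; first by rewrite subrr normr0
    divr_ge0 // ltW.
  have nwv : 0 < `|w - v| by rewrite normr_gt0 subr_eq0.
  rewrite ler_pdivlMr //; apply: le_trans (cost_sub_le sv sw).
  have -> : cost sigma (w - v) =
      `|w - v| * cost sigma (`|w - v|^-1 *: (w - v)).
    by rewrite -costZ ?(ltW nwv) // scalerA divff ?lt0r_neq0 // scale1r.
  rewrite ler_pM2l //; apply: cmin; rewrite in_setE /K /= normrZ normfV
    normr_id.
  by rewrite mulVf // lt0r_neq0.
exists (`|v| + B / cost sigma c); split=> [|M hM w sw /=]; first exact: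
  num_real.
apply: le_trans (ltW hM); rewrite -[w in leLHS](subrK v) addrC.
by apply: le_trans (ler_normD _ _) _; rewrite lerD2l key.
Qed.

(** A nonzero side at w persists in a neighbourhood of w, which meets the face of v. Conversely, the
    segment from a point of the face of w to v lies in the face of v right after its start. *)
Lemma closure_face v w : face H w `<=` closure (face H v) <->
  (forall i, side i w != 0 -> side i v = side i w).
Proof.
split=> [sub i sw|hs].
  have cw : closure (face H v) w by apply: sub.
  pose U := [set x : V | 0 < side i w * val_at i x].
  have : nbhs w U.
    apply: open_nbhs_nbhs; split; last first.
      rewrite /U /= sideE -normrEsg normr_gt0; move: sw; rewrite sideE.
      by apply: contra => /eqP ->; rewrite sgr0.
    apply: (open_comp (f := fun x : V => side i w * val_at i x)
      (D := [set y : R | 0 < y])); last exact: open_gt.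
    move=> x _.
    apply: (@continuousM _ V (fun=> side i w) (fun y => val_at i y)).
      exact: cst_continuous.
    apply: (@continuousB _ R^o V (fun y => dot i y) (fun=> offset i)).
      exact: dot_continuous.
    exact: cst_continuous.
  move=> /cw[x [xv Ux]]; rewrite -(xv i); move: Ux; rewrite /U /= !sideE.
  move: sw; rewrite sideE sgr_eq0; case: (ltrgt0P (val_at i w)) => // w0 _.
    by rewrite (gtr0_sg w0) mul1r => x0; rewrite gtr0_sg.
  by rewrite (ltr0_sg w0) mulN1r oppr_gt0 => x0; rewrite ltr0_sg.
move=> x xw B /nbhs_ballP[e /= e0 eB].
pose t := Num.min 1 (e / 2 / (`|v - x| + 1)).
have d1 : 0 < `|v - x| + 1 by rewrite ltr_wpDl.
have t0 : 0 < t by rewrite lt_min ltr01 !divr_gt0.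
have t1 : t <= 1 by rewrite ge_min lexx.
exists (x + t *: (v - x)); split.
  move=> i; have := hs i; have := xw i; rewrite !sideE val_at_move val_atB =>
    xi.
  have [x0|x0] := eqVneq (val_at i x) 0.
    by move=> _; rewrite x0 add0r subr0 sgrM gtr0_sg // mul1r.
  move=> /(_ _) hv; rewrite -xi sgr_eq0 in hv; have {}hv := hv x0.
  by rewrite sg_convex ?hv // (ltW t0).
apply: eB; rewrite mx_norm_ball /ball_ /= opprD addrA subrr sub0r normrN.
rewrite normrZ gtr0_norm //; apply: (@le_lt_trans _ _ (e / 2)); last first.
  by rewrite ltr_pdivrMr // ltr_pMr // ltr1n.
apply: (@le_trans _ _ (t * (`|v - x| + 1))); first by rewrite ler_wpM2l ?(ltW
  t0) // lerDl.
by rewrite -ler_pdivlMr // ge_min lexx orbT.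
Qed.

End Topology.

(** * Counting faces with a given span *)

Section CountFibers.
Context (TP TQ : eqType) (lt : rel TP) (rk : TP -> nat) (EP : seq TP).
Context (EQ : seq TQ) (sp : TQ -> TP).
Hypothesis lt_trans : transitive lt.
Hypothesis lt_rk : forall x y, lt x y -> (rk x < rk y)%N.
Hypothesis uniqP : uniq EP.
Hypothesis sp_in : forall F, F \in EQ -> sp F \in EP.

Local Notation sgn x := ((-1) ^+ rk x : int).

Lemma sign_gap x y : lt x y -> (-1) ^+ gap rk x y = - (sgn x * sgn y).
Proof.
move=> /lt_rk xy; have -> : rk y = (rk x + (gap rk x y).+1)%N by rewrite /gap;
  lia.
by rewrite exprD signrMK exprS mulN1r opprK.
Qed.

(** Grouped by [sp], the Euler relation becomes a relation between the fibre sizes; multiplied by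
    the sign of w it is the hypothesis of [mob_inversion]. *)
Lemma count_fibers_zas (e : int) (p : pred TQ) x y : x \in EP -> lt x y ->
  (forall F, F \in EQ -> p F -> lt (sp F) y) ->
  (forall w, w \in EP -> lt w y ->
     \sum_(F <- EQ | p F && ((w == sp F) || lt w (sp F))) sgn (sp F) =
     sgn w - e * sgn y) ->
  (count (fun F => p F && (sp F == x)) EQ)%:Z = zas lt rk EP e x y.
Proof.
move=> xE xy pE H; pose nn z := (count (fun F => p F && (sp F == z)) EQ)%:Z.
apply: (mob_inversion lt_trans lt_rk (n := nn)) => // w wE wy.
have {wE} wE : w \in EP by case: wE => [->|].
have ss z : sgn z * sgn z = 1 by rewrite -expr2 sqrr_sign.
suff key : sgn w * nn w + \sum_(z <- EP | lt w z && lt z y) sgn z * nn z =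
    sgn w - e * sgn y.
  rewrite (eq_bigr (fun z => - sgn w * (sgn z * nn z))); last first.
    by move=> z /andP[wz _]; rewrite sign_gap // !mulNr mulrA.
  rewrite -mulr_sumr mulNr opprK (sign_gap wy).
  have := congr1 ( *%R (sgn w)) key.
  by rewrite mulrDr mulrBr mulrA !ss mul1r mulrCA mulrN => ->.
have cnt z : count (fun F => (p F && ((w == sp F) || lt w (sp F))) && (sp F ==
  z)) EQ
    = if (w == z) || lt w z then count (fun F => p F && (sp F == z)) EQ else
      0%N.
  case: ifP => wz; last first.
    rewrite (@eq_count _ _ pred0) ?count_pred0 // => F /=.
    by case: (sp F =P z) => [->|_]; rewrite ?wz ?andbF.
  by apply: eq_count => F /=; case: (sp F =P z) => [->|_]; rewrite ?wz ?andbT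
    ?andbF.
rewrite -H // (sum_over_fibers uniqP sp_in (fun z => sgn z)).
rewrite [RHS](bigD1_seq w) //= cnt eqxx /= mulrzz; congr (_ + _).
rewrite [RHS]big_mkcond [LHS]big_mkcond; apply: eq_bigr => z _ /=.
rewrite cnt eq_sym; have [->|zw] := eqVneq w z.
  by case: ifP => // /andP[/lt_rk]; rewrite ltnn.
case wz: (lt w z) => //=; case: ifP => [_|zy]; first by rewrite mulrzz.
rewrite (@eq_in_count _ _ pred0) ?count_pred0 // => F FE /=.
by apply/negbTE; apply: contraFN zy => /andP[/(pE F FE) + /eqP <-].
Qed.

End CountFibers.

(** * Flats, spans of faces, and the two Euler relations *)

Section Flats.
Context (R : realType) (n : nat) (H : arrangement R n).
Local Notation I := 'I_(nb_hyp H).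
Local Notation V := 'rV[R]_n.
Implicit Types (i g : I) (u v w : V) (Z : {set I}) (X Y F G : set V).
Local Notation closure := topology_structure.closure.

Definition sides v : seq (I * R) := [seq (i, side i v) | i <- enum I].
Definition zero_sides Z : seq (I * R) := [seq (i, 0) | i <- enum Z].

Lemma sat_sides v w : sat (sides v) w <-> face H v w.
Proof.
split=> [/satP s i|fw]; last by apply/satP => p /mapP[i _ ->].
by apply: (s (i, side i v)); apply: map_f; rewrite mem_enum.
Qed.

Lemma cell_sides v : cell (sides v) = face H v.
Proof. by apply/seteqP; split=> w /sat_sides. Qed.

Lemma nonempty_sides v : nonempty (sides v).
Proof. by apply/nonemptyP; exists v; apply/sat_sides. Qed.

Lemma zeros_sides v : zeros (sides v) = [set i : I | side i v == 0]%SET.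
Proof.
apply/setP => i; rewrite !inE; apply/mapP/eqP => [[j _ [-> ->]] //|i0].
by exists i; rewrite ?mem_enum // i0.
Qed.

Lemma sat_zero_sides Z w : sat (zero_sides Z) w <-> flat Z w.
Proof.
split=> [/satP s i iZ|fw]; last first.
  by apply/satP => p /mapP[i + ->]; rewrite mem_enum => /fw.
by apply: (s (i, 0)); apply: map_f; rewrite mem_enum.
Qed.

Lemma cell_zero_sides Z : cell (zero_sides Z) = flat Z.
Proof. by apply/seteqP; split=> w /sat_zero_sides. Qed.

Lemma zeros_zero_sides Z : zeros (zero_sides Z) = Z.
Proof.
apply/setP => i; rewrite !inE; apply/mapP/idP => [[j + [->]]|iZ].
  by rewrite mem_enum.
by exists i; rewrite ?mem_enum.
Qed.

Lemma dom_zero_sides Z : dom (zero_sides Z) = Z.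
Proof.
apply/setP => i; rewrite !inE /zero_sides -map_comp.
apply/mapP/idP => [[j + ->]|iZ]; first by rewrite mem_enum.
by exists i; rewrite ?mem_enum.
Qed.

Lemma rho_face v : rho (face H v) = rkZ [set i : I | side i v == 0]%SET.
Proof. by rewrite -cell_sides rho_cell ?nonempty_sides // zeros_sides. Qed.

Lemma rho_flat Z : flat Z !=set0 -> rho (flat Z) = rkZ Z.
Proof.
move=> [v vZ]; rewrite -cell_zero_sides rho_cell ?zeros_zero_sides //.
by apply/nonemptyP; exists v; apply/sat_zero_sides.
Qed.

Definition zero_set X : {set I} := [set i | `[< X `<=` @hyp R n H i >]]%SET.
(** The smallest flat containing X. For a face it is the affine span, since a face is open in the
    intersection of the hyperplanes containing it. *)
Definition span X : set V := flat (zero_set X).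

Lemma zero_setP X i : reflect (forall v, X v -> side i v = 0) (i \in zero_set
  X).
Proof.
rewrite inE; apply: (iffP (asboolP _)) => h v /h; first by move/hypE.
by move=> h0; apply/hypE.
Qed.

Lemma sub_span X : X `<=` span X.
Proof. by move=> v Xv i /zero_setP; apply. Qed.

Lemma span_flat Z : span (flat Z) = flat Z.
Proof.
apply/seteqP; split; last exact: sub_span.
by move=> v h i iZ; apply: h; apply/zero_setP => w; apply.
Qed.

Lemma zero_set_face v : zero_set (face H v) = [set i : I | side i v == 0]%SET.
Proof.
apply/setP => i; rewrite [RHS]inE; apply/zero_setP/eqP => [h|v0 w wv].
  exact: h.
by rewrite wv.
Qed.

Lemma rho_span_face v : rho (span (face H v)) = rho (face H v).
Proof.
rewrite rho_face -zero_set_face rho_flat //.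
by exists v; apply: sub_span.
Qed.

Lemma span_face_sub v Z : span (face H v) `<=` flat Z <-> flat Z v.
Proof.
split=> [h|vZ w h i iZ]; first by apply/h/sub_span.
apply: h; apply/zero_setP => x xv; rewrite xv; exact: vZ.
Qed.

Lemma intersectionsP X : intersections H X <-> exists Z, X = flat Z.
Proof.
have e Z : \bigcap_(i in [set` Z]) @hyp R n H i = flat Z.
  by apply/seteqP; split=> v h i iZ; apply/hypE; apply: h.
by split=> -[Z ->]; exists Z; rewrite e.
Qed.

Lemma rho_flat_lt X Y : intersections H X -> intersections H Y ->
  Y !=set0 -> Y `<=` X -> X != Y -> (rho X < rho Y)%N.
Proof.
move=> /intersectionsP[Z1 ->] /intersectionsP[Z2 ->] [v v2] s21 ne.
have sz : zero_set (flat Z1) \subset zero_set (flat Z2).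
  by apply/subsetP => i /zero_setP h; apply/zero_setP => w /s21 /h.
have v1 := s21 v v2.
have e Z w : flat Z w -> rho (flat Z) = rkZ (zero_set (flat Z)).
  move=> Zw; rewrite -[in LHS]span_flat rho_flat //.
  by exists w; apply: sub_span.
rewrite (e _ _ v1) (e _ _ v2) ltnNge; apply: contra ne => r.
apply/eqP/seteqP; split=> //; rewrite -[flat Z1]span_flat -[X in _ `<=`
  X]span_flat.
by apply: flat_rk_eq sz r _; apply/sub_span/v2.
Qed.

(** At equal rank the hyperplanes through w also contain v, and [closure_face] makes the other sides
    agree, so the faces coincide. *)
Lemma rho_face_lt v w : face H w `<=` closure (face H v) ->
  face H v != face H w -> (rho (face H v) < rho (face H w))%N.
Proof.
move=> /closure_face h ne; rewrite !rho_face.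
have sz : [set i : I | side i v == 0]%SET \subset [set i : I | side i w ==
  0]%SET.
  apply/subsetP => i; rewrite !inE => /eqP v0; apply/negPn/negP => w0.
  by move: (w0); rewrite -(h i w0) v0 eqxx.
rewrite ltnNge; apply: contra ne => r; apply/eqP.
have wf : flat [set i : I | side i w == 0]%SET w by move=> i; rewrite inE =>
  /eqP.
have /(_ v) vf := flat_rk_eq sz r wf.
have e i : side i v = side i w.
  have [w0|/h //] := eqVneq (side i w) 0.
  by rewrite w0; apply: vf; rewrite ?inE ?w0 // => j; rewrite inE => /eqP.
by apply/seteqP; split=> x xv i; rewrite xv.
Qed.

(** Each constraint of the smaller face agrees with that of the larger one or is an equation, so the
    recession cones are nested. *)
Lemma bounded_closure_face v w : face H w `<=` closure (face H v) ->
  bounded_set (face H v) -> bounded_set (face H w).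
Proof.
move=> /closure_face h; rewrite -!cell_sides.
rewrite !bounded_cellP ?nonempty_sides // => b u ru; apply: b => p /mapP[i _
  ->] /=.
have [h1 h2] : 0 <= side i w * dot i u /\ (side i w = 0 -> dot i u = 0).
  by apply: (ru (i, side i w)); apply: map_f; rewrite mem_enum.
have [w0|/h -> //] := eqVneq (side i w) 0.
by rewrite h2 // mulr0.
Qed.

Hypothesis Hess : essential H.

Lemma essential_orth u : (forall i, dot i u = 0) -> u = 0.
Proof.
move=> h; apply: trmx_inj; apply: (row_full_inj Hess).
rewrite trmx0 mulmx0; apply/row_matrixP => i; rewrite row_mul rowK row0.
by apply/dot_eq0.
Qed.

Lemma essential_rk : rkZ [set: I]%SET = n.
Proof.
apply/anti_leq; rewrite rk_le.
apply: (@leq_trans (\rank (\matrix_(i < nb_hyp H) normal i))).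
  by rewrite (eqP Hess).
apply/mxrankS/row_subP => i; rewrite rowK.
by apply: normal_sub_span; rewrite in_setT.
Qed.

Lemma sum_flat_faces Z : flat Z !=set0 ->
  \sum_(F <- all_faces H | `[< F `<=` flat Z >]) (-1) ^+ rho F =
  (-1) ^+ rho (flat Z) :> int.
Proof.
move=> [v vZ]; rewrite -cell_zero_sides.
rewrite -(sum_euler_faces (s := enum I) (tau := zero_sides Z)) //.
  by move=> i; left; rewrite mem_enum.
by apply/nonemptyP; exists v; apply/sat_zero_sides.
Qed.

(** The recession weight is 1 on the flat. On a face all hyperplanes are prescribed; as their
    normals have rank n, a linear recession cone is zero, and the weight is (-1)^(n + rho) on
    bounded faces and 0 on the others. *)
Lemma sum_bounded_flat_faces Z : flat Z !=set0 ->
  \sum_(F <- all_faces H | `[< F `<=` flat Z >])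
    (if `[< bounded_set F >] then (-1) ^+ rho F else 0) = (-1) ^+ n :> int.
Proof.
move=> [v vZ]; rewrite -cell_zero_sides -(sum_cells_faces _ (s := enum I));
  last first.
  by move=> i; left; rewrite mem_enum.
have -> : (-1) ^+ n = (-1) ^+ n * recession_weight (zero_sides Z) :> int.
  rewrite /recession_weight (_ : nonempty _ && lineal _).
    by rewrite dom_zero_sides zeros_zero_sides addnn -mul2n exprM sqrrN
      !expr1n mulr1.
  apply/andP; split; first by apply/nonemptyP; exists v; apply/sat_zero_sides.
  apply/asboolP => u ru i; rewrite dom_zero_sides => iZ.
  have [] := ru (i, 0); first by apply: map_f; rewrite mem_enum.
  by move=> _; apply.
rewrite -(sum_cells (enum I) _ (@cut_recession_weight R n H)) mulr_sumr.
rewrite big_seq [RHS]big_seq; apply: eq_bigr => sigma sc; rewrite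
  /recession_weight.
have dmT : dom sigma = [set: I]%SET.
  by apply/setP => i; rewrite in_setT; apply: (cells_dom sc); left; rewrite
    mem_enum.
case: ifP => ns; rewrite ?mulr0 //=.
have -> : lineal sigma = `[< bounded_set (cell sigma) >].
  apply/asboolP/asboolP => [h|/(bounded_cellP ns) h u /h -> i _]; last first.
    by rewrite /dot mul0mx mxE.
  apply/(bounded_cellP ns) => u /h; rewrite dmT => o.
  by apply: essential_orth => i; apply: o; rewrite in_setT.
case: ifP => _; rewrite ?mulr0 //.
by rewrite rho_cell // dmT essential_rk exprD mulrA -exprD addnn -mul2n exprM
  sqrrN !expr1n mul1r.
Qed.

End Flats.

Local Notation set0 := classical_sets.set0.

Lemma mem_dom_some (R : realType) (n : nat) (E : seq (set 'rV[R]_n)) X :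
  (Some X \in (None : option (set 'rV[R]_n)) :: Some set0 :: map Some E) =
  (X == set0) || (X \in E).
Proof.
rewrite !in_cons /=; congr (_ || _).
by apply/mapP/idP => [[Y YE [->]] //|XE]; exists X.
Qed.

(** * The posets of flats and of unbounded faces *)

Section OptionPoset.
Context (R : realType) (n : nat).
Local Notation V := 'rV[R]_n.
Context (car : set (option (set V))) (r : rel (option (set V))).
Context (le : set V -> set V -> Prop) (E : seq (set V)).
Hypothesis r_bot : forall y, r None y.
Hypothesis r_none : forall X, r (Some X) None = false.
Hypothesis r_some : forall X Y, r (Some X) (Some Y) = `[< le X Y >].
Hypothesis le_trans : forall X Y Z, le X Y -> le Y Z -> le X Z.
Hypothesis le_set0 : forall X, le X set0.
Hypothesis set0_le : forall X, le set0 X -> X = set0.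
Hypothesis E_neq0 : set0 \notin E.
Hypothesis E_rho : forall X, X \in E -> (rho X <= n)%N.
Hypothesis E_rho_lt : forall X Y, X \in E -> Y \in E -> le X Y -> X != Y ->
  (rho X < rho Y)%N.

(** The common form of [L_hat0] and [Q]: sets under a transitive relation with the empty set on top,
    [None] below everything, and E listing the elements in between. *)
Let P := @RankedPoset _ car r None (Some set0) (@rank_opt R n).
Let oE : seq (elt P) := map Some E.
Local Notation lt := (@clt P oE).

Lemma clt_some X Y : X \in E -> Y \in E ->
  lt (Some X) (Some Y) = (X != Y) && `[< le X Y >].
Proof.
move=> XE YE; rewrite /clt !mem_dom_some XE YE !orbT /= /plt /P /= r_some.
by congr (~~ _ && _).
Qed.

Lemma opt_clt_rk x y : lt x y -> (prk x < prk y)%N.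
Proof.
case: x y => [X|] [Y|] //; rewrite /clt /plt /P /=; last first.
  by rewrite r_none !andbF.
rewrite !mem_dom_some r_some => /and3P[XE YE /andP[XY /asboolP XleY]].
have {}XY : X != Y by apply: contraNneq XY => ->.
rewrite ltnS; case/orP: XE => [/eqP X0|XE].
  by move: XleY XY; rewrite X0 => /set0_le ->; rewrite eqxx.
case/orP: YE => [/eqP ->|YE]; last exact: E_rho_lt.
by rewrite {2}/rho eqxx ltnS E_rho.
Qed.

Lemma opt_clt_trans : transitive lt.
Proof.
move=> y x z xy yz; have := ltn_trans (opt_clt_rk xy) (opt_clt_rk yz) => xz.
case/and3P: xy => xD yD /andP[_ xy]; case/and3P: yz => _ zD /andP[_ yz].
apply/and3P; split=> //; apply/andP; split.
  by apply: contraTneq xz => ->; rewrite ltnn.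
move: xy yz; case: x y z {xz xD yD zD} => [X|] [Y|] [Z|] //=; rewrite ?r_none
  ?r_bot //.
by rewrite !r_some => /asboolP XY /asboolP YZ; apply/asboolP/(le_trans XY YZ).
Qed.

Lemma opt_bot_clt x : x \in oE -> lt None x.
Proof.
by case/mapP => X XE ->; rewrite /clt mem_dom_some XE orbT mem_head /plt /P /=
  r_bot.
Qed.

Lemma opt_clt_top x : x \in oE -> lt x (Some set0).
Proof.
case/mapP => X XE ->; rewrite /clt !mem_dom_some XE orbT eqxx /plt /P /= r_some.
apply/andP; split; last exact/asboolP.
by apply: contraNneq E_neq0 => -[<-].
Qed.

Lemma opt_bot_top : lt None (Some set0).
Proof. by rewrite /clt mem_dom_some eqxx mem_head /plt /P /= r_bot. Qed.

Lemma opt_chain_sum (A : nzRingType) (mon : seq bool -> A) : uniq E ->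
  mon [::] = 1 -> (forall s t, mon s * mon t = mon (s ++ t)) ->
  (forall x, car x <-> x \in (None : option (set V)) :: Some set0 :: oE) ->
  \sum_(S : {set 'I_(ab_degree P)})
    mon [seq i \in S | i <- enum 'I_(ab_degree P)] *~ flag_h S =
  chain_sum lt (@rank_opt R n) oE (mon [:: false] - mon [:: true])
    (mon [:: true]) None (Some set0).
Proof.
move=> uE mon_nil monM carE; apply: (ab_sum_chain_sum (P := P) (E := oE)) => //.
- by rewrite map_inj_uniq // => X Y [].
- by move=> x xE; apply/carE; rewrite !in_cons xE !orbT.
- by move=> x /carE.
- exact: opt_clt_trans.
- exact: opt_clt_rk.
- exact: opt_bot_clt.
- exact: opt_bot_top.
Qed.

End OptionPoset.

(** * Flats and unbounded faces of an arrangement *)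

Section Posets.
Context (R : realType) (n : nat) (H : arrangement R n).
Hypothesis Hess : essential H.
Hypothesis Hnc : noncentral H.
Local Notation I := 'I_(nb_hyp H).
Local Notation V := 'rV[R]_n.
Local Notation closure := topology_structure.closure.
Implicit Types (X Y F G W : set V).

(** Several Z may cut out the same flat; the empty flat is left out because it is the top of the
    poset. *)
Definition flats : seq (set V) :=
  undup [seq @flat R n H Z | Z <- enum {set I} & `[< flat Z !=set0 >]].
Definition unbounded_faces : seq (set V) :=
  [seq F <- all_faces H | ~~ `[< bounded_set F >]].

Lemma mem_flats X : (X \in flats) <-> intersections H X /\ X !=set0.
Proof.
rewrite mem_undup; split.
  case/mapP => Z; rewrite mem_filter => /andP[/asboolP Z0 _] ->.
  by split=> //; apply/intersectionsP; exists Z.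
case=> /intersectionsP[Z ->] Z0; apply: map_f.
by rewrite mem_filter mem_enum andbT; apply/asboolP.
Qed.

Lemma mem_unbounded_faces F :
  (F \in unbounded_faces) <-> faces H F /\ ~ bounded_set F.
Proof.
rewrite mem_filter; split=> [/andP[/asboolP bF /mem_all_faces] //|[fF bF]].
by apply/andP; split; [apply/asboolP | apply/mem_all_faces].
Qed.

Lemma set0_flats : set0 \notin flats.
Proof. by apply/negP => /mem_flats[_ []]. Qed.

Lemma set0_unbounded_faces : set0 \notin unbounded_faces.
Proof.
apply/negP => /mem_unbounded_faces[[v e] _].
by have : set0 v by rewrite e.
Qed.

Lemma flats_rho X : X \in flats -> (rho X <= n)%N.
Proof.
case/mem_flats => /intersectionsP[Z ->] Z0.
by rewrite rho_flat // rk_le.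
Qed.

Lemma unbounded_faces_rho F : F \in unbounded_faces -> (rho F <= n)%N.
Proof. by case/mem_unbounded_faces => -[v ->] _; rewrite rho_face rk_le. Qed.

Lemma flats_rho_lt X Y : X \in flats -> Y \in flats -> Y `<=` X -> X != Y ->
  (rho X < rho Y)%N.
Proof. by move=> /mem_flats[X1 _] /mem_flats[Y1 Y0]; exact: (rho_flat_lt X1 Y1
  Y0). Qed.

Lemma faces_rho_lt F G : F \in unbounded_faces -> G \in unbounded_faces ->
  G `<=` closure F -> F != G -> (rho F < rho G)%N.
Proof.
move=> /mem_unbounded_faces[[v ->] _] /mem_unbounded_faces[[w ->] _].
exact: rho_face_lt.
Qed.

Lemma closure_trans F G K : G `<=` closure F -> K `<=` closure G ->
  K `<=` closure F.
Proof.
move=> GF KG x /KG /(closureS GF); rewrite -(proj1 (closure_id _)) //.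
exact: closed_closure.
Qed.

Lemma span_in_flats F : F \in unbounded_faces -> span H F \in flats.
Proof.
case/mem_unbounded_faces => -[v ->] _; apply/mem_flats; split.
  by apply/intersectionsP; exists (zero_set H (face H v)).
by exists v; apply: sub_span.
Qed.

Local Notation EP := (map Some flats : seq (elt (L_hat0 H))).
Local Notation EQ := (map Some unbounded_faces : seq (elt (Q H))).
Local Notation ltP := (@clt (L_hat0 H) EP).
Local Notation ltQ := (@clt (Q H) EQ).

Lemma ltP_some X Y : X \in flats -> Y \in flats ->
  ltP (Some X) (Some Y) = (X != Y) && `[< Y `<=` X >].
Proof. exact: (@clt_some R n _ _ (fun X Y => Y `<=` X)). Qed.

Lemma ltQ_some F G : F \in unbounded_faces -> G \in unbounded_faces ->
  ltQ (Some F) (Some G) = (F != G) && `[< G `<=` closure F >].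
Proof. exact: (@clt_some R n _ _ (fun F G => G `<=` closure F)). Qed.

Definition sp (x : elt (Q H)) : elt (L_hat0 H) :=
  if x is Some F then Some (span H F) else None.

Lemma span_le W F : W \in flats -> F \in unbounded_faces ->
  (Some W == sp (Some F)) || ltP (Some W) (sp (Some F)) =
  `[< span H F `<=` W >].
Proof.
move=> Wf Ff; rewrite ltP_some ?span_in_flats //.
have -> : (Some W == sp (Some F)) = (W == span H F) by [].
by case: eqP => //= e; apply/esym/asboolP; rewrite e.
Qed.

Lemma rho_span F : F \in unbounded_faces -> rho (span H F) = rho F.
Proof. by case/mem_unbounded_faces => -[v ->] _; rewrite rho_span_face. Qed.

(** The faces in W whose closure contains G are the faces in the cell [tau], which prescribes the
    sides of the hyperplanes not containing G and the equations of W. The claim is the Euler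
    relation of this cell with the term of G moved across. *)
Lemma sum_below W G : W \in flats -> G \in unbounded_faces ->
  span H G `<=` W ->
  \sum_(F <- EQ | ltQ F (Some G) && ((Some W == sp F) || ltP (Some W) (sp F)))
    (-1) ^+ rank_opt (sp F) =
  (-1) ^+ rank_opt (Some W) - 1 * (-1) ^+ rank_opt (sp (Some G)) :> int.
Proof.
move=> Wf Gf; have [[w eG] bG] := proj1 (mem_unbounded_faces G) Gf.
have [/intersectionsP[Z eW] _] := proj1 (mem_flats W) Wf.
rewrite eW eG span_face_sub -eG => wZ.
pose s := enum (zero_set H G).
pose tau : seq (I * R) := [seq (i, side i w) | i <- enum (~: zero_set H
  G)%SET] ++
  zero_sides Z.
have zG i : (i \in zero_set H G) = (side i w == 0).
  by rewrite eG zero_set_face inE.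
have satE v : sat tau v <->
    (forall i : I, side i w != 0 -> side i v = side i w) /\ flat Z v.
  rewrite /sat all_cat -/(sat _ v) -/(sat (zero_sides Z) v); split.
    case/andP=> /satP s1 /sat_zero_sides fz; split=> // i wi.
    by apply: (s1 (i, side i w)); apply: map_f; rewrite mem_enum inE zG.
  case=> h /sat_zero_sides ->; rewrite andbT; apply/satP => p /mapP[i + ->].
  by rewrite mem_enum inE zG => /h.
have cover i : i \in s \/ i \in dom tau.
  rewrite mem_enum zG; case: eqP => [|/eqP wi]; [by left | right].
  rewrite inE /tau map_cat mem_cat -map_comp; apply/orP; left.
  by apply/mapP; exists i => //; rewrite mem_enum inE zG.
have nt : nonempty tau by apply/nonemptyP; exists w; apply/satE; split.
have := sum_euler_faces cover nt; rewrite (rho_cell nt).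
have -> : zeros tau = Z.
  apply/setP => i; rewrite inE mem_cat; apply/orP/idP => [[]|iZ].
  - case/mapP => j; rewrite mem_enum inE zG => + [_ e].
    by rewrite -e eqxx.
  - by move=> h; rewrite -(zeros_zero_sides Z) inE.
  by right; move: iZ; rewrite -{1}(zeros_zero_sides Z) inE.
rewrite -rho_flat; last by exists w.
have Ga : G \in all_faces H by apply/mem_all_faces; exists w.
have Gtau : `[< G `<=` cell tau >].
  apply/asboolP => x; rewrite eG => xw; apply/satE; split=> // i iZ.
  by rewrite xw wZ.
rewrite -big_filter (bigD1_seq G) /=; last 2 first.
- by rewrite mem_filter Gtau.
- exact/filter_uniq/uniq_face_list.
(* [rank_opt] exceeds [rho] by one, so every sign is opposite to that in the Euler relation. *)
rewrite big_filter_cond => E; rewrite /= rho_span // !exprS !mulN1r mul1r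
  opprK -E opprD addrAC addNr add0r.
rewrite big_map big_filter_cond -sumrN big_seq_cond [RHS]big_seq_cond.
apply: eq_big => [F|F /and3P[Fa /asboolP bF _]].
  case Fa: (F \in all_faces H) => //=; have [v eF] := proj1 (mem_all_faces H
    F) Fa.
  have FtauE : `[< F `<=` cell tau >] = `[< G `<=` closure F >] && `[< span H
    F `<=` W >].
    apply/asboolP/andP => [sub|[/asboolP GF /asboolP FW] x].
      have /satE[v1 v2] : sat tau v by apply: sub; rewrite eF.
      by split; apply/asboolP; rewrite ?eF ?eG ?eW ?closure_face ?span_face_sub.
    rewrite eF => xv; apply/satE; move: GF FW; rewrite eF eG eW.
    rewrite closure_face span_face_sub => h1 h2.
    by split=> i hi; rewrite xv; [apply: h1 | apply: h2].
  (* A bounded F cannot have the unbounded G in its closure. *)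
  rewrite FtauE; have [bF|bF] := asboolP (bounded_set F) => /=.
    case: asboolP => //= GF; case: bG; move: GF bF; rewrite eF eG.
    exact: bounded_closure_face.
  have Ff : F \in unbounded_faces by apply/mem_unbounded_faces; split=> //;
    exists v.
  by rewrite ltQ_some // -eW (span_le Wf Ff) -andbA andbC.
have Ff : F \in unbounded_faces.
  by apply/mem_unbounded_faces; split=> //; apply/mem_all_faces.
by rewrite /= rho_span // exprS mulN1r.
Qed.

(** The Euler relation over all faces in W minus the one over the bounded faces; the latter gives
    the sign of the top, of rank n + 2. *)
Lemma sum_unbounded W : W \in flats ->
  \sum_(F <- EQ | predT F && ((Some W == sp F) || ltP (Some W) (sp F)))
    (-1) ^+ rank_opt (sp F) =
  (-1) ^+ rank_opt (Some W) - (-1) * (-1) ^+ rank_opt (Some (set0 : set V)) :>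
    int.
Proof.
move=> Wf; have [/intersectionsP[Z eW] W0] := proj1 (mem_flats W) Wf.
rewrite eW in W0 *.
have E1 := sum_flat_faces W0; have E2 := sum_bounded_flat_faces Hess W0.
have r0 : rho (set0 : set V) = n.+1 by rewrite /rho eqxx.
rewrite /= r0 !exprS !mulN1r !opprK -E1 -E2 addrC -sumrB.
rewrite big_map big_filter_cond big_mkcond [RHS]big_mkcond big_seq [RHS]big_seq.
apply: eq_bigr => F Fa; have [bF|bF] := asboolP (bounded_set F).
  by rewrite subrr /=; case: ifP.
have Ff : F \in unbounded_faces.
  by apply/mem_unbounded_faces; split=> //; apply/mem_all_faces.
rewrite -eW (span_le Wf Ff) /= rho_span // exprS mulN1r sub0r.
have [v eF] := proj1 (mem_all_faces H F) Fa.
congr (if _ then _ else _); apply/asboolP/asboolP; rewrite eF eW.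
  by move=> h x xv; apply/h/sub_span.
by move=> h; apply/span_face_sub/h.
Qed.

Lemma uniq_EP : uniq EP.
Proof. by rewrite map_inj_uniq ?undup_uniq // => X Y []. Qed.

Lemma uniq_unbounded_faces : uniq unbounded_faces.
Proof. exact/filter_uniq/uniq_face_list. Qed.

Lemma sp_in_EP y : y \in EQ -> sp y \in EP.
Proof. by case/mapP => F Ff ->; apply/map_f/span_in_flats. Qed.

Lemma supset_trans X Y W : Y `<=` X -> W `<=` Y -> W `<=` X.
Proof. by move=> YX WY x /WY /YX. Qed.

Lemma set0_sub X : set0 `<=` X.
Proof. by []. Qed.

Lemma sup_set0 X : X `<=` set0 -> X = set0.
Proof. by move=> h; apply/seteqP; split. Qed.

Lemma sup_closure_set0 X : X `<=` closure set0 -> X = set0.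
Proof. by rewrite closure0; apply: sup_set0. Qed.

Lemma ltP_rk x y : ltP x y -> (rank_opt x < rank_opt y)%N.
Proof.
exact: (@opt_clt_rk R n _ _ (fun X Y => Y `<=` X) flats (fun=> erefl)
  (fun _ _ => erefl) sup_set0 flats_rho flats_rho_lt).
Qed.

Lemma ltP_trans : transitive ltP.
Proof.
exact: (@opt_clt_trans R n _ _ (fun X Y => Y `<=` X) flats (fun=> isT)
  (fun=> erefl) (fun _ _ => erefl) supset_trans
  sup_set0 flats_rho flats_rho_lt).
Qed.

Lemma ltQ_rk x y : ltQ x y -> (rank_opt x < rank_opt y)%N.
Proof.
exact: (@opt_clt_rk R n _ _ (fun F G => G `<=` closure F) unbounded_faces
  (fun=> erefl) (fun _ _ => erefl) sup_closure_set0 unbounded_faces_rho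
  faces_rho_lt).
Qed.

Lemma ltQ_trans : transitive ltQ.
Proof.
exact: (@opt_clt_trans R n _ _ (fun F G => G `<=` closure F) unbounded_faces
  (fun=> isT) (fun=> erefl) (fun _ _ => erefl) closure_trans
  sup_closure_set0 unbounded_faces_rho faces_rho_lt).
Qed.

Lemma ltP_bot x : x \in EP -> ltP None x.
Proof. exact: opt_bot_clt. Qed.

Lemma ltQ_bot x : x \in EQ -> ltQ None x.
Proof. exact: opt_bot_clt. Qed.

Lemma ltP_top x : x \in EP -> ltP x (Some set0).
Proof.
exact: (@opt_clt_top R n _ _ (fun X Y => Y `<=` X) flats (fun _ _ => erefl)
  set0_sub set0_flats).
Qed.

Lemma ltQ_top x : x \in EQ -> ltQ x (Some set0).
Proof.
exact: (@opt_clt_top R n _ _ (fun F G => G `<=` closure F) unbounded_faces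
  (fun _ _ => erefl) (fun F => @set0_sub (closure F))
  set0_unbounded_faces).
Qed.

(** A strict relation between faces changes the rank, and spans keep the rank, so the spans stay
    distinct. *)
Lemma sp_lt x y : x \in EQ -> y \in EQ -> ltQ x y -> ltP (sp x) (sp y).
Proof.
case/mapP => F Ff ->; case/mapP => G Gf ->.
rewrite ltQ_some // => /andP[FG /asboolP GF].
rewrite ltP_some ?span_in_flats //; apply/andP; split.
  apply: contraTneq (faces_rho_lt Ff Gf GF FG) => e.
  by rewrite -(rho_span Ff) e rho_span // ltnn.
apply/asboolP; have [[v eF] _] := proj1 (mem_unbounded_faces F) Ff.
have [[w eG] _] := proj1 (mem_unbounded_faces G) Gf.
move: GF; rewrite eF eG => /closure_face h.
apply/span_face_sub => i; rewrite zero_set_face inE => /eqP v0.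
apply/eqP/negPn/negP => w0; move: (w0).
by rewrite -(h i w0) v0 eqxx.
Qed.

Lemma count_below x y : x \in EP -> y \in EQ -> ltP x (sp y) ->
  (count (fun z => ltQ z y && (sp z == x)) EQ)%:Z =
  zas ltP (@rank_opt R n) EP 1 x (sp y).
Proof.
move=> xE yE xy; apply: (count_fibers_zas ltP_trans ltP_rk uniq_EP sp_in_EP)
  => //.
  by move=> z zE zy; apply: sp_lt.
case/mapP: yE => G Gf -> w /mapP[W Wf ->].
rewrite ltP_some ?span_in_flats // => /andP[_ /asboolP GW].
exact: sum_below.
Qed.

Lemma count_all x : x \in EP ->
  (count (fun z => sp z == x) EQ)%:Z =
  zas ltP (@rank_opt R n) EP (-1) x (Some set0).
Proof.
move=> xE; apply: (count_fibers_zas (p := predT) ltP_trans ltP_rk uniq_EP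
  sp_in_EP) => //.
- exact: ltP_top.
- by move=> z zE _; apply/ltP_top/sp_in_EP.
by move=> w /mapP[W Wf ->] _; apply: sum_unbounded.
Qed.

Lemma carrier_L x : carrier (r := L_hat0 H) x <->
  x \in (None : option (set V)) :: Some set0 :: map Some flats.
Proof.
case: x => [X|]; last by rewrite mem_head; split.
rewrite mem_dom_some; split.
  move=> iX; have [->|X0] := eqVneq X set0; first by [].
  by rewrite orFb; apply/mem_flats; split=> //; apply/set0P.
case/orP => [/eqP ->|/mem_flats[] //].
(* Non-centrality makes the empty set an intersection of hyperplanes, so the top is in the
   carrier. *)
apply/intersectionsP; exists [set: I]%SET; rewrite -Hnc.
apply/seteqP; split=> v h i _; first by apply/hypE; apply: h.
by apply/hypE; apply: h; rewrite in_setT.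
Qed.

Lemma carrier_Q x : carrier (r := Q H) x <->
  x \in (None : option (set V)) :: Some set0 :: map Some unbounded_faces.
Proof.
case: x => [X|]; last by rewrite mem_head; split.
rewrite mem_dom_some /=; split.
  by case=> [->|/mem_unbounded_faces ->]; rewrite ?eqxx ?orbT.
by case/orP => [/eqP ->|/mem_unbounded_faces]; [left | right].
Qed.

Lemma ab_index_L : ab_index (L_hat0 H) =
  chain_sum ltP (@rank_opt R n) EP (a - b) b None (Some set0).
Proof.
exact: (@opt_chain_sum R n _ _ (fun X Y => Y `<=` X) flats (fun=> isT)
  (fun=> erefl) (fun _ _ => erefl) supset_trans
  sup_set0 flats_rho flats_rho_lt Zab mon (undup_uniq _) mon_nil monM
    carrier_L).
Qed.

Lemma ab_index_Q : ab_index (Q H) =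
  chain_sum ltQ (@rank_opt R n) EQ (a - b) b None (Some set0).
Proof.
exact: (@opt_chain_sum R n _ _ (fun F G => G `<=` closure F) unbounded_faces
  (fun=> isT) (fun=> erefl) (fun _ _ => erefl) closure_trans
  sup_closure_set0 unbounded_faces_rho faces_rho_lt Zab mon
  uniq_unbounded_faces mon_nil monM carrier_Q).
Qed.

End Posets.

Theorem theorem1p38 (R : realType) (n : nat) (H : arrangement R n)
    (Hess : essential H) (Hnc : noncentral H) :
  ab_index (Q H) = phi_ub (ab_index (L_hat0 H)).
Proof.
rewrite phi_ubE (ab_index_L Hnc) ab_index_Q.
(* The abstract algebra becomes Z<a,b> with [linext], and the posets are compared along [sp]. *)
apply: (@transfer_phi _ _ (fun f v => linext (fun w : word => f w) v)
  mon_nil monM Zab_ind (fun f => linext_mon _) (fun f => linextB _)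
  _ _ _ _ _ _ _ _ (@sp R n H)).
- exact: ltP_trans.
- exact: ltP_rk.
- exact: ltQ_rk.
- exact: uniq_EP.
- exact: sp_in_EP.
- by move=> _ /mapP[F Ff ->]; rewrite /= rho_span.
- exact: sp_lt.
- by [].
- by [].
- exact: ltP_bot.
- exact: ltP_top.
- exact: ltQ_bot.
- exact: ltQ_top.
- exact: count_below.
- exact: count_all.
Qed.
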